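(* Let $V=Kx_1\oplus Kx_2$ be a quantum plane with $x_i\in V_{g_i}^{\chi_i}$, let $R=\mathcal B(V)$, $H=K[\Gamma]$ and $A:=R\#H$. Let $B:=A(a_1,a_2,a)$ be a lifting of $A$, and let $\alpha:=\gamma_a\ast\gamma_1\ast\gamma_2\in Z^2_H(A,K)$ be the cocycle (described in the context) that twists $A$ into $B$, i.e. $A^\alpha=B$, so that $B=R^{\alpha_R}\#_{\varepsilon_{\alpha_R}}H$. Suppose that one of the following conditions holds: (i) $\alpha=\gamma_i$ for $i=1$ or $2$; (ii) $\alpha=\gamma_1\ast\gamma_2$ and $g_1^{r_1}g_2^{r_2}\neq 1$; (iii) the parameter $a$ is nonzero, $r$ is odd or $r=2$, and $(g_1g_2)^r\neq 1$, where $r:=r_1=r_2$; (iv) the parameter $a$ is nonzero, $r:=r_1=r_2=2r'>2$, $(g_1g_2)^{tr'}\neq 1$ for all $t\in\{1,2,3\}$, and $(g_1g_2)^{r'}g_2^{r}\neq 1\neq g_1^{r}(g_1g_2)^{r'}$. Then for $\lambda$ the total integral on the group algebra $H=K[\Gamma]$, $$\lambda\circ\varepsilon_{\alpha_R}=\alpha_R .$$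
   Context: $K$ is a field of characteristic $0$, $\Gamma$ is a finite abelian group, $H=K[\Gamma]$. A quantum plane $V=Kx_1\oplus Kx_2$ with $x_i\in V_{g_i}^{\chi_i}$ is given by $g_1,g_2\in\Gamma$ and characters $\chi_1,\chi_2:\Gamma\to K^\times$ such that $\chi_1(g_2)\chi_2(g_1)=1$ and $\chi_i(g_i)$ is a primitive $r_i$th root of unity, $r_i\ge2$. $R=\mathcal B(V)$ is its Nichols algebra and $A=R\#H$ the Radford biproduct: the Hopf algebra generated by $\Gamma$ and $x_1,x_2$ with relations those of $\Gamma$ and $hx_i=\chi_i(h)x_ih$ ($h\in\Gamma$), $x_i^{r_i}=0$, $x_2x_1=\chi_1(g_2)x_1x_2$; elements of $\Gamma$ are grouplike, $\Delta(x_i)=x_i\otimes1+g_i\otimes x_i$, $\varepsilon(x_i)=0$. It has basis $x_1^{n_1}x_2^{n_2}g$, $0\le n_i<r_i$, $g\in\Gamma$, and $R$ is identified with the span of the $x_1^{n_1}x_2^{n_2}$. The lifting $A(a_1,a_2,a)$ is the Hopf algebra with the same generators and coproduct and relations $hx_i=\chi_i(h)x_ih$, $x_i^{r_i}=a_i(1-g_i^{r_i})$, $x_2x_1=\chi_1(g_2)x_1x_2+a(1-g_1g_2)$, where the scalars satisfy: $a_i\ne0$ implies $g_i^{r_i}\ne1$ and $\chi_i^{r_i}=\varepsilon$; $a\neq0$ implies $g_1g_2\ne1$ and $\chi_1\chi_2=\varepsilon$ (whence $r_1=r_2$). $Z^2_H(A,K)$ is the set of convolution invertible maps $\gamma:A\otimes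 A\to K$ with $\gamma(hx\otimes yh')=\varepsilon(h)\varepsilon(h')\gamma(x\otimes y)$ for $h,h'\in H$, $\gamma(x\otimes 1)=\gamma(1\otimes x)=\varepsilon(x)$ and $\gamma(y_{(1)}\otimes z_{(1)})\gamma(x\otimes y_{(2)}z_{(2)})=\gamma(x_{(1)}\otimes y_{(1)})\gamma(x_{(2)}y_{(2)}\otimes z)$. $A^\gamma$ is the coalgebra $A$ with multiplication $m_{A^\gamma}=\gamma\ast m_A\ast\gamma^{-1}$ ($\ast$ = convolution). The following maps equal $\varepsilon\otimes\varepsilon$ on all $X\otimes Y$ with $X,Y$ monomials $x_1^{n_1}x_2^{n_2}$, apart from the listed values, and are extended to $A\otimes A$ by $H$-bilinearity: $\gamma_i$ ($i=1,2$) has $\gamma_i(x_i^m\otimes x_i^{r_i-m})=a_i$ for $0<m<r_i$; $\gamma_a$ has $\gamma_a(x_2^m\otimes x_1^m)=(m)!_q\,a^m$ for $0\le m<r_1$, where $q=\chi_1(g_1)$ and $(m)!_q=\prod_{k=1}^m(1+q+\dots+q^{k-1})$. It is known that $\alpha=\gamma_a\ast\gamma_1\ast\gamma_2\in Z_H^2(A,K)$ and $A^\alpha=B$ (identifying the bases $x_1^{n_1}x_2^{n_2}g$). In (i), $\alpha=\gamma_i$ means the other parameters vanish; in (ii), $\alpha=\gamma_1\ast\gamma_2$ means $a=0$. $\alpha_R$ is the restriction of $\alpha$ to $R\otimes R$. Let $\pi:A\to H$, $\pi(rh)=\varepsilon(r)h$ for $r\in R$, $h\in H$ (an $H$-bilinear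 coalgebra projection, also viewed as $A^\alpha\to H$ since $A^\alpha=A$ as a coalgebra). The cocycle $\varepsilon_{\alpha_R}:R\otimes R\to H$ occurring in the known decomposition $A^\alpha=R^{\alpha_R}\#_{\varepsilon_{\alpha_R}}H$ is $\varepsilon_{\alpha_R}(r\otimes s)=\pi(m_{A^\alpha}(r\otimes s))$ for $r,s\in R$. The total integral $\lambda:H\to K$ is the linear map with $\lambda(g)=\delta_{g,e}$ for $g\in\Gamma$, $e$ the unit of $\Gamma$. *)

(* Defs.v *)
From HB Require Import structures.
From mathcomp Require Import all_boot all_order all_algebra all_fingroup ring.
From Stdlib Require Import ClassicalEpsilon.

Set Implicit Arguments.
Unset Strict Implicit.
Unset Printing Implicit Defensive.

Import GRing.Theory.
Local Open Scope ring_scope.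

(* A character of G with values in K; the values are automatically units. *)
Definition is_character (K : fieldType) (G : finGroupType) (chi : G -> K) :=
  chi 1%g = 1 /\ forall g h, chi (g * h)%g = chi g * chi h.

(* The braided vector space V = K x_1 (+) K x_2 with x_i in V_{g_i}^{chi_i}. *)
Record quantum_plane (K : fieldType) (G : finGroupType) := QuantumPlane {
  g1 : G;
  g2 : G;
  chi1 : G -> K;
  chi2 : G -> K;
  r1 : nat;
  r2 : nat;
  chi1_char : is_character chi1;
  chi2_char : is_character chi2;
  chi12 : chi1 g2 * chi2 g1 = 1;
  r1_ge2 : (2 <= r1)%N;
  r2_ge2 : (2 <= r2)%N;
  chi1_prim : r1.-primitive_root (chi1 g1);
  chi2_prim : r2.-primitive_root (chi2 g2)
}.

(* The scalars a_1, a_2, a for which the lifting A(a_1, a_2, a) is defined. *)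
Definition lifting_scalars (K : fieldType) (G : finGroupType)
    (D : quantum_plane K G) (a1 a2 a : K) :=
  [/\ a1 != 0 -> (g1 D ^+ r1 D)%g != 1%g /\ (forall g, chi1 D g ^+ r1 D = 1),
      a2 != 0 -> (g2 D ^+ r2 D)%g != 1%g /\ (forall g, chi2 D g ^+ r2 D = 1)
    & a != 0 -> (g1 D * g2 D)%g != 1%g /\ (forall g, chi1 D g * chi2 D g = 1)].

(* The algebra A = B(V) # K[G], on the basis x_1^{n_1} x_2^{n_2} g with
   0 <= n_i < r_i: the index ((n_1, n_2), g) stands for x_1^{n_1} x_2^{n_2} g.
   The ring structure below is the one forced by the relations; see mon_genE
   (the basis), grpM, grp_x1, grp_x2, x1_nil, x2_nil and x2_x1 (the relations). *)
Definition bidx (K : fieldType) (G : finGroupType) (D : quantum_plane K G) :=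
  ('I_(r1 D) * 'I_(r2 D) * G)%type.

Definition biproduct (K : fieldType) (G : finGroupType)
  (D : quantum_plane K G) : Type := {ffun bidx D -> K^o}.

HB.instance Definition _ (K : fieldType) (G : finGroupType)
  (D : quantum_plane K G) :=
  GRing.Lmodule.copy (biproduct D) {ffun bidx D -> K^o}.

Section Biproduct.
Variables (K : fieldType) (G : finGroupType) (D : quantum_plane K G).
Local Notation A := (biproduct D).
Local Notation I := (bidx D).
Implicit Types (x y z : A) (g h : G).

Definition coef x (i : I) : K := (x : {ffun I -> K^o}) i.

(* x_1^{n_1} x_2^{n_2} g, which vanishes as soon as some n_i >= r_i. *)
Definition mon (n1 n2 : nat) g : A :=
  [ffun i : I => [&& i.1.1 == n1 :> nat, i.1.2 == n2 :> nat & i.2 == g]%:R : K^o].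

Definition bas (i : I) : A := mon i.1.1 i.1.2 i.2.

(* x_1^{n_1} x_2^{n_2} g * x_1^{m_1} x_2^{m_2} h is this scalar times
   x_1^{n_1 + m_1} x_2^{n_2 + m_2} gh. *)
Definition mulc (n2 : nat) g (m1 m2 : nat) : K :=
  chi1 D g ^+ m1 * chi2 D g ^+ m2 * chi1 D (g2 D) ^+ (n2 * m1).

Definition bimul x y : A :=
  \sum_(i : I) \sum_(j : I) (coef x i * coef y j * mulc i.1.2 i.2 j.1.1 j.1.2)
    *: mon (i.1.1 + j.1.1) (i.1.2 + j.1.2) (i.2 * j.2)%g.

Lemma coefE x i : (x : {ffun I -> K^o}) i = coef x i. Proof. by []. Qed.

Lemma coefD x y i : coef (x + y) i = coef x i + coef y i.
Proof. by rewrite /coef ffunE. Qed.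

Lemma coefZ c x i : coef (c *: x) i = c * coef x i.
Proof. by rewrite /coef ffunE. Qed.

Lemma coef_mon n1 n2 g i :
  coef (mon n1 n2 g) i = [&& i.1.1 == n1 :> nat, i.1.2 == n2 :> nat & i.2 == g]%:R.
Proof. by rewrite /coef ffunE. Qed.

Lemma coef_bas i j : coef (bas i) j = (j == i)%:R.
Proof. by rewrite coef_mon; case: i j => [[i1 i2] g] [[j1 j2] h] /=; rewrite andbA. Qed.

Lemma biP x y : (forall i, coef x i = coef y i) -> x = y.
Proof. by move=> E; apply/ffunP=> i; exact: E. Qed.

Lemma coef_sum (J : finType) (F : J -> A) i :
  coef (\sum_j F j) i = \sum_j coef (F j) i.
Proof. by rewrite /coef sum_ffunE. Qed.

Lemma basE x : x = \sum_i coef x i *: bas i.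
Proof.
apply: biP => i; rewrite coef_sum (bigD1 i) //= coefZ coef_bas eqxx mulr1.
by rewrite big1 ?addr0 // => j ji; rewrite coefZ coef_bas eq_sym (negPf ji) mulr0.
Qed.

Lemma mon_out n1 n2 g : ~~ ((n1 < r1 D) && (n2 < r2 D))%N -> mon n1 n2 g = 0.
Proof.
move=> h; apply: biP => i; rewrite coef_mon /coef ffunE.
case: eqP => //= e1; case: eqP => //= e2.
by rewrite -e1 -e2 !ltn_ord in h.
Qed.

Lemma mon_in n1 n2 g (h1 : (n1 < r1 D)%N) (h2 : (n2 < r2 D)%N) :
  mon n1 n2 g = bas (Ordinal h1, Ordinal h2, g).
Proof. by []. Qed.

Lemma bimulDl x y z : bimul (x + y) z = bimul x z + bimul y z.
Proof.
rewrite /bimul -big_split; apply: eq_bigr => i _ /=.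
rewrite -big_split; apply: eq_bigr => j _ /=.
by rewrite coefD !mulrDl scalerDl.
Qed.

Lemma bimulDr x y z : bimul x (y + z) = bimul x y + bimul x z.
Proof.
rewrite /bimul -big_split; apply: eq_bigr => i _ /=.
rewrite -big_split; apply: eq_bigr => j _ /=.
by rewrite coefD mulrDr mulrDl scalerDl.
Qed.

Lemma bimulZl c x y : bimul (c *: x) y = c *: bimul x y.
Proof.
rewrite /bimul scaler_sumr; apply: eq_bigr => i _ /=.
rewrite scaler_sumr; apply: eq_bigr => j _ /=.
by rewrite coefZ scalerA !mulrA.
Qed.

Lemma bimulZr c x y : bimul x (c *: y) = c *: bimul x y.
Proof.
rewrite /bimul scaler_sumr; apply: eq_bigr => i _ /=.
rewrite scaler_sumr; apply: eq_bigr => j _ /=.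
by rewrite coefZ scalerA !mulrA (mulrC c).
Qed.

Lemma bimul0 x : (bimul 0 x = 0) * (bimul x 0 = 0).
Proof.
have E : (0 : A) = (0 : K) *: (0 : A) by rewrite scale0r.
by split; rewrite E ?bimulZl ?bimulZr !scale0r.
Qed.

Lemma bimul_suml (J : finType) (F : J -> A) y :
  bimul (\sum_j F j) y = \sum_j bimul (F j) y.
Proof.
by apply: (big_morph (bimul^~ y)) => [u v|]; [exact: bimulDl | rewrite bimul0].
Qed.

Lemma bimul_sumr (J : finType) (F : J -> A) x :
  bimul x (\sum_j F j) = \sum_j bimul x (F j).
Proof.
by apply: (big_morph (bimul x)) => [u v|]; [exact: bimulDr | rewrite bimul0].
Qed.

Lemma bimul_bas i j : bimul (bas i) (bas j) =
  mulc i.1.2 i.2 j.1.1 j.1.2 *: mon (i.1.1 + j.1.1) (i.1.2 + j.1.2) (i.2 * j.2)%g.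
Proof.
rewrite /bimul (bigD1 i) //= (bigD1 j) //= !coef_bas !eqxx !mul1r.
rewrite big1 => [|k kj]; last by rewrite !coef_bas (negPf kj) mulr0 mul0r scale0r.
rewrite big1 ?addr0 // => k ki; rewrite big1 // => l _.
by rewrite !coef_bas (negPf ki) !mul0r scale0r.
Qed.

Lemma bimul_mon n1 n2 g m1 m2 h : bimul (mon n1 n2 g) (mon m1 m2 h) =
  mulc n2 g m1 m2 *: mon (n1 + m1) (n2 + m2) (g * h)%g.
Proof.
have [/andP[n1r n2r]|h1] := boolP ((n1 < r1 D) && (n2 < r2 D))%N; last first.
  rewrite (mon_out _ h1) bimul0 mon_out ?scaler0 //.
  by apply: contra h1 => /andP[u v]; rewrite !(leq_ltn_trans (leq_addr _ _) u, leq_ltn_trans (leq_addr _ _) v).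
have [/andP[m1r m2r]|h2] := boolP ((m1 < r1 D) && (m2 < r2 D))%N; last first.
  rewrite (mon_out _ h2) bimul0 mon_out ?scaler0 //.
  by apply: contra h2 => /andP[u v]; rewrite !(leq_ltn_trans (leq_addl _ _) u, leq_ltn_trans (leq_addl _ _) v).
by rewrite (mon_in _ n1r n2r) (mon_in _ m1r m2r) bimul_bas.
Qed.

Lemma chi1M g h : chi1 D (g * h)%g = chi1 D g * chi1 D h.
Proof. exact: (chi1_char D).2. Qed.

Lemma chi2M g h : chi2 D (g * h)%g = chi2 D g * chi2 D h.
Proof. exact: (chi2_char D).2. Qed.

Lemma chi1_1 : chi1 D 1%g = 1. Proof. exact: (chi1_char D).1. Qed.

Lemma chi2_1 : chi2 D 1%g = 1. Proof. exact: (chi2_char D).1. Qed.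

Lemma bimulA : associative bimul.
Proof.
move=> x y z.
have step (f g : A -> A) (E : forall u, f u = \sum_i coef u i *: f (bas i))
    (E' : forall u, g u = \sum_i coef u i *: g (bas i)) :
    (forall i, f (bas i) = g (bas i)) -> f =1 g.
  by move=> fg u; rewrite E E'; apply: eq_bigr => i _; rewrite fg.
have El u v : bimul u v = \sum_i coef u i *: bimul (bas i) v.
  rewrite {1}(basE u) (bimul_suml (fun i => coef u i *: bas i)).
  by apply: eq_bigr => i _; rewrite bimulZl.
have Er u v : bimul u v = \sum_i coef v i *: bimul u (bas i).
  rewrite {1}(basE v) (bimul_sumr (fun i => coef v i *: bas i)).
  by apply: eq_bigr => i _; rewrite bimulZr.
have Sl (F : I -> A) c v :
    bimul (\sum_i c i *: F i) v = \sum_i c i *: bimul (F i) v.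
  rewrite (bimul_suml (fun i => c i *: F i)).
  by apply: eq_bigr => i _; rewrite bimulZl.
have Sr (F : I -> A) c v :
    bimul v (\sum_i c i *: F i) = \sum_i c i *: bimul v (F i).
  rewrite (bimul_sumr (fun i => c i *: F i)).
  by apply: eq_bigr => i _; rewrite bimulZr.
apply: (step (bimul^~ (bimul y z)) (fun x => bimul (bimul x y) z)) => [u|u|i].
- exact: El.
- by rewrite {1}(El u) Sl.
apply: (step (fun y => bimul (bas i) (bimul y z))
             (fun y => bimul (bimul (bas i) y) z)) => [u|u|j].
- by rewrite {1}(El u) Sr.
- by rewrite {1}(Er _ u) Sl.
apply: (step (fun z => bimul (bas i) (bimul (bas j) z))) => [u|u|k].
- by rewrite {1}(Er _ u) Sr.
- by rewrite {1}(Er _ u).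
rewrite /bas !bimul_mon bimulZl bimulZr !bimul_mon.
rewrite !scalerA !addnA mulgA; congr (_ *: _).
rewrite /mulc chi1M chi2M mulnDr mulnDl !exprD !exprMn; ring.
Qed.

Lemma bimul1l : left_id (mon 0 0 1%g) bimul.
Proof.
move=> x; rewrite {1}(basE x) bimul_sumr [RHS]basE; apply: eq_bigr => i _.
rewrite bimulZr bimul_mon /mulc chi1_1 chi2_1 !expr1n mul0n expr0 !mulr1.
by rewrite scale1r mul1g.
Qed.

Lemma bimul1r : right_id (mon 0 0 1%g) bimul.
Proof.
move=> x; rewrite {1}(basE x) bimul_suml [RHS]basE; apply: eq_bigr => i _.
rewrite bimulZl bimul_mon /mulc muln0 !expr0 !mulr1.
by rewrite scale1r !addn0 mulg1.
Qed.

Lemma mon1_neq0 : mon 0 0 1%g != 0 :> A.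
Proof.
apply/eqP => E.
pose i : I := (Ordinal (ltnW (r1_ge2 D)), Ordinal (ltnW (r2_ge2 D)), 1%g).
have := congr1 (fun x => coef x i) E; rewrite /= coef_mon !eqxx /coef ffunE /=.
by apply/eqP; rewrite oner_neq0.
Qed.

End Biproduct.

HB.instance Definition _ (K : fieldType) (G : finGroupType)
    (D : quantum_plane K G) :=
  GRing.Zmodule_isNzRing.Build (biproduct D) (@bimulA K G D) (@bimul1l K G D)
    (@bimul1r K G D) (@bimulDl K G D) (fun x y z => bimulDr x y z)
    (@mon1_neq0 K G D).

HB.instance Definition _ (K : fieldType) (G : finGroupType)
    (D : quantum_plane K G) :=
  GRing.Lmodule_isLalgebra.Build K (biproduct D)
    (fun c x y => esym (bimulZl c x y)).

HB.instance Definition _ (K : fieldType) (G : finGroupType)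
    (D : quantum_plane K G) :=
  GRing.Lalgebra_isAlgebra.Build K (biproduct D)
    (fun c x y => esym (bimulZr c x y)).

Section Presentation.
Variables (K : fieldType) (G : finGroupType) (D : quantum_plane K G).
Local Notation A := (biproduct D).

Definition grp (g : G) : A := mon D 0 0 g.
Definition x1 : A := mon D 1 0 1%g.
Definition x2 : A := mon D 0 1 1%g.

Lemma monM n1 n2 g m1 m2 h : mon D n1 n2 g * mon D m1 m2 h =
  mulc D n2 g m1 m2 *: mon D (n1 + m1) (n2 + m2) (g * h)%g.
Proof. exact: bimul_mon. Qed.

Lemma x1Xn n : x1 ^+ n = mon D n 0 1%g.
Proof.
elim: n => // n IHn; rewrite exprS IHn monM /mulc.
by rewrite chi1_1 chi2_1 !expr1n expr0 !mulr1 scale1r mulg1.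
Qed.

Lemma x2Xn n : x2 ^+ n = mon D 0 n 1%g.
Proof.
elim: n => // n IHn; rewrite exprS IHn monM /mulc.
by rewrite chi1_1 chi2_1 !expr1n muln0 expr0 !mulr1 scale1r mulg1.
Qed.

Lemma mon_genE n1 n2 g : mon D n1 n2 g = x1 ^+ n1 * x2 ^+ n2 * grp g.
Proof.
rewrite x1Xn x2Xn !monM /mulc chi1_1 chi2_1 !expr1n mul0n expr0 !mulr1 scale1r.
by rewrite monM /mulc muln0 !expr0 !mulr1 scale1r !addn0 !add0n !mul1g.
Qed.

Lemma grp1 : grp 1%g = 1. Proof. by []. Qed.

Lemma grpM g h : grp (g * h)%g = grp g * grp h.
Proof. by rewrite monM /mulc !expr0 !mulr1 scale1r. Qed.

Lemma grp_x1 g : grp g * x1 = chi1 D g *: (x1 * grp g).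
Proof. by rewrite !monM /mulc !(expr0, expr1) !mulr1 scale1r mulg1 mul1g. Qed.

Lemma grp_x2 g : grp g * x2 = chi2 D g *: (x2 * grp g).
Proof. by rewrite !monM /mulc muln0 !(expr0, expr1, mulr1, mul1r) scale1r mulg1 mul1g. Qed.

Lemma x1_nil : x1 ^+ r1 D = 0.
Proof. by rewrite x1Xn mon_out // ltnn. Qed.

Lemma x2_nil : x2 ^+ r2 D = 0.
Proof. by rewrite x2Xn mon_out // ltnn andbF. Qed.

Lemma x2_x1 : x2 * x1 = chi1 D (g2 D) *: (x1 * x2).
Proof.
by rewrite !monM /mulc chi1_1 chi2_1 !expr1n !mul1r !expr0 scale1r muln1 expr1.
Qed.

(* R: the span of the monomials x_1^{n_1} x_2^{n_2}. *)
Definition in_R (r : A) :=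
  exists c : 'I_(r1 D) -> 'I_(r2 D) -> K,
    r = \sum_n1 \sum_n2 c n1 n2 *: (x1 ^+ n1 * x2 ^+ n2).

(* A (x) A: the function t stands for \sum_p t p (bas p.1 (x) bas p.2). *)
Local Notation A2 := {ffun bidx D * bidx D -> K^o}.

Definition tens (x y : A) : A2 := [ffun p => coef x p.1 * coef y p.2 : K^o].

(* (x (x) y)(x' (x) y') = xx' (x) yy'; see tmul_tens. *)
Definition tmul (s t : A2) : A2 :=
  \sum_p \sum_q (s p * t q) *: tens (bas p.1 * bas q.1) (bas p.2 * bas q.2).

Definition Delta_x1 : A2 := tens x1 1 + tens (grp (g1 D)) x1.
Definition Delta_x2 : A2 := tens x2 1 + tens (grp (g2 D)) x2.

(* Delta is multiplicative, hence its value on x_1^{n_1} x_2^{n_2} g is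
   Delta(x_1)^{n_1} Delta(x_2)^{n_2} (g (x) g). *)
Definition Delta (x : A) : A2 :=
  \sum_i coef x i *: iter i.1.1 (tmul Delta_x1)
    (iter i.1.2 (tmul Delta_x2) (tens (grp i.2) (grp i.2))).

Definition counit (x : A) : K :=
  \sum_i coef x i * ((i.1.1 == 0 :> nat) && (i.1.2 == 0 :> nat))%:R.

(* A linear map A (x) A -> E is represented by the bilinear map A -> A -> E. *)
Definition bilinear_map (E : lmodType K) (f : A -> A -> E) :=
  (forall c x x' y, f (c *: x + x') y = c *: f x y + f x' y) /\
  (forall c x y y', f x (c *: y + y') = c *: f x y + f x y').

(* Convolution f * g (x (x) y) = f (x_(1) (x) y_(1)) g (x_(2) (x) y_(2)), the
   values of f and g being multiplied by op. *)
Definition conv (E F H : lmodType K) (op : E -> F -> H)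
    (f : A -> A -> E) (g : A -> A -> F) (x y : A) : H :=
  \sum_p \sum_q (Delta x p * Delta y q) *:
    op (f (bas p.1) (bas q.1)) (g (bas p.2) (bas q.2)).

Definition form := A -> A -> K^o.

Definition fconv : form -> form -> form := conv (fun a b : K^o => a * b : K^o).

Definition eps2 : form := fun x y => counit x * counit y.

Definition is_conv_inverse (gam del : form) :=
  [/\ bilinear_map del, forall x y, fconv gam del x y = eps2 x y
    & forall x y, fconv del gam x y = eps2 x y].

(* The convolution inverse of gam, when gam is convolution invertible. *)
Definition conv_inv (gam : form) : form :=
  epsilon (inhabits eps2) (is_conv_inverse gam).

(* The multiplication gam * m_A * gam^{-1} of A^gam. *)
Definition twisted_mul (gam : form) : A -> A -> A :=
  conv (fun (z : A) (a : K^o) => (a : K) *: z)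
    (conv (fun (a : K^o) (z : A) => (a : K) *: z) gam (fun x y => x * y))
    (conv_inv gam).

(* The H-bilinear form on A (x) A with value c n1 n2 m1 m2 on X (x) Y, where
   X = x_1^{n1} x_2^{n2} and Y = x_1^{m1} x_2^{m2}. As
   gX = chi1(g)^{n1} chi2(g)^{n2} Xg, its value on Xg (x) Yh has to be
   chi1(g)^{-n1} chi2(g)^{-n2} c n1 n2 m1 m2; see Hext_mon and Hext_Hbilinear. *)
Definition Hext (c : nat -> nat -> nat -> nat -> K) : form := fun x y =>
  \sum_(i : bidx D) \sum_(j : bidx D) coef x i * coef y j *
    (chi1 D i.2 ^- i.1.1 * chi2 D i.2 ^- i.1.2 * c i.1.1 i.1.2 j.1.1 j.1.2).

Definition eps_val (n1 n2 m1 m2 : nat) : K :=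
  [&& n1 == 0, n2 == 0, m1 == 0 & m2 == 0]%N%:R.

Definition gamma1 (a1 : K) : form := Hext (fun n1 n2 m1 m2 =>
  if [&& 0 < n1 < r1 D, n2 == 0, m1 == r1 D - n1 & m2 == 0]%N then a1
  else eps_val n1 n2 m1 m2).

Definition gamma2 (a2 : K) : form := Hext (fun n1 n2 m1 m2 =>
  if [&& n1 == 0, 0 < n2 < r2 D, m1 == 0 & m2 == r2 D - n2]%N then a2
  else eps_val n1 n2 m1 m2).

Definition qfact (q : K) (m : nat) : K :=
  \prod_(1 <= k < m.+1) \sum_(j < k) q ^+ j.

Definition gamma_a (a : K) : form := Hext (fun n1 n2 m1 m2 =>
  if [&& n1 == 0, n2 < r1 D, m1 == n2 & m2 == 0]%N
  then qfact (chi1 D (g1 D)) n2 * a ^+ n2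
  else eps_val n1 n2 m1 m2).

Definition alpha (a1 a2 a : K) : form :=
  fconv (fconv (gamma_a a) (gamma1 a1)) (gamma2 a2).

(* Elements of H = K[G] are given by their coefficients on the basis G;
   pi(Xg) = eps(X) g for X = x_1^{n_1} x_2^{n_2}. *)
Definition Hpi (x : A) : {ffun G -> K} :=
  [ffun g => \sum_(n1 < r1 D) \sum_(n2 < r2 D)
     coef x (n1, n2, g) * counit (x1 ^+ n1 * x2 ^+ n2)].

Definition eps_cocycle (gam : form) (r s : A) : {ffun G -> K} :=
  Hpi (twisted_mul gam r s).

Lemma lifting_r1_r2 a1 a2 a : lifting_scalars D a1 a2 a -> a != 0 -> r1 D = r2 D.
Proof.
case=> _ _ H /H[_ chi12V].
have z12 : chi1 D (g1 D) * chi2 D (g2 D) = 1.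
  rewrite -[LHS]mulr1 -[X in _ * X = _](chi12 D) [chi1 D (g2 D) * _]mulrC mulrACA.
  by rewrite chi12V [chi2 D (g2 D) * _]mulrC chi12V mulr1.
have zX n : (chi1 D (g1 D) ^+ n == 1) = (chi2 D (g2 D) ^+ n == 1).
  have := congr1 (fun z => z ^+ n) z12; rewrite exprMn expr1n => e.
  by apply/eqP/eqP => f; rewrite f ?mul1r ?mulr1 in e.
apply/eqP; rewrite eqn_dvd (prim_order_dvd (chi1_prim D)) zX.
rewrite (prim_expr_order (chi2_prim D)) eqxx /= (prim_order_dvd (chi2_prim D)) -zX.
by rewrite (prim_expr_order (chi1_prim D)).
Qed.

Lemma Hext_bilinear c : bilinear_map (Hext c).
Proof.
split=> [k x x' y|k x y y']; rewrite /Hext scaler_sumr -big_split;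
  apply: eq_bigr => i _; rewrite scaler_sumr -big_split; apply: eq_bigr => j _.
  by rewrite /= coefD coefZ [k *: _]mulrA !mulrDl !mulrA.
by rewrite /= coefD coefZ /GRing.scale /=; ring.
Qed.

Lemma counit_mon (n1 : 'I_(r1 D)) (n2 : 'I_(r2 D)) g :
  counit (mon D n1 n2 g) = ((n1 == 0 :> nat) && (n2 == 0 :> nat))%:R.
Proof.
rewrite (mon_in _ (ltn_ord n1) (ltn_ord n2)) /counit.
rewrite (bigD1 (Ordinal (ltn_ord n1), Ordinal (ltn_ord n2), g)) //=.
rewrite coef_bas eqxx mul1r big1 ?addr0 // => i ne.
by rewrite coef_bas (negPf ne) mul0r.
Qed.

Lemma mulE (x y : A) :
  x * y = \sum_i \sum_j (coef x i * coef y j) *: (bas i * bas j).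
Proof.
apply: eq_bigr => i _; apply: eq_bigr => j _.
by rewrite monM scalerA.
Qed.

Lemma tmul_tens (x y x' y' : A) :
  tmul (tens x y) (tens x' y') = tens (x * x') (y * y').
Proof.
apply/ffunP => k; rewrite /tmul sum_ffunE [RHS]ffunE mulE [in RHS](mulE y).
rewrite !coef_sum big_distrlr /=.
rewrite pair_bigA; apply: eq_bigr => -[p1 p2] _; rewrite !coef_sum big_distrlr /=.
rewrite sum_ffunE pair_bigA; apply: eq_bigr => -[q1 q2] _ /=.
by rewrite !ffunE /= !coefZ /GRing.scale /=; ring.
Qed.

Lemma tmulDl s s' t : tmul (s + s') t = tmul s t + tmul s' t.
Proof.
rewrite /tmul -big_split; apply: eq_bigr => p _ /=; rewrite -big_split.
by apply: eq_bigr => q _ /=; rewrite ffunE mulrDl scalerDl.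
Qed.

Lemma Delta_mon n1 n2 g : (n1 < r1 D)%N -> (n2 < r2 D)%N ->
  Delta (mon D n1 n2 g) =
  iter n1 (tmul Delta_x1) (iter n2 (tmul Delta_x2) (tens (grp g) (grp g))).
Proof.
move=> h1 h2; rewrite (mon_in _ h1 h2) /Delta.
rewrite (bigD1 (Ordinal h1, Ordinal h2, g)) //=.
rewrite coef_bas eqxx scale1r big1 ?addr0 // => i ne.
by rewrite coef_bas (negPf ne) scale0r.
Qed.

Lemma Delta_grp g : Delta (grp g) = tens (grp g) (grp g).
Proof. by rewrite Delta_mon // ltnW ?r1_ge2 ?r2_ge2. Qed.

Lemma DeltaE_x1 : Delta x1 = tens x1 1 + tens (grp (g1 D)) x1.
Proof.
rewrite Delta_mon ?(r1_ge2 D) ?(ltnW (r2_ge2 D)) //=.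
by rewrite tmulDl !tmul_tens grp1 !mulr1.
Qed.

Lemma DeltaE_x2 : Delta x2 = tens x2 1 + tens (grp (g2 D)) x2.
Proof.
rewrite Delta_mon ?(r2_ge2 D) ?(ltnW (r1_ge2 D)) //=.
by rewrite tmulDl !tmul_tens grp1 !mulr1.
Qed.

Lemma Hext_bas c i j : Hext c (bas i) (bas j) =
  chi1 D i.2 ^- i.1.1 * chi2 D i.2 ^- i.1.2 * c i.1.1 i.1.2 j.1.1 j.1.2.
Proof.
rewrite /Hext (bigD1 i) //= (bigD1 j) //= !coef_bas !eqxx !mul1r.
rewrite big1 => [|k kj]; last by rewrite !coef_bas (negPf kj) mulr0 mul0r.
rewrite big1 ?addr0 // => k ki; rewrite big1 // => l _.
by rewrite !coef_bas (negPf ki) !mul0r.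
Qed.

Lemma Hext_mon c (n1 m1 : 'I_(r1 D)) (n2 m2 : 'I_(r2 D)) :
  Hext c (x1 ^+ n1 * x2 ^+ n2) (x1 ^+ m1 * x2 ^+ m2) = c n1 n2 m1 m2.
Proof.
have E k1 k2 : x1 ^+ k1 * x2 ^+ k2 = mon D k1 k2 1%g by rewrite mon_genE mulr1.
rewrite !E (mon_in _ (ltn_ord n1) (ltn_ord n2)) (mon_in _ (ltn_ord m1) (ltn_ord m2)).
by rewrite Hext_bas /= chi1_1 chi2_1 !expr1n !invr1 !mul1r.
Qed.

Lemma chi1_neq0 g : chi1 D g != 0.
Proof.
apply/eqP => e; have := chi1_1 D; rewrite -(mulgV g) chi1M e mul0r.
by apply/eqP; rewrite eq_sym oner_neq0.
Qed.

Lemma chi2_neq0 g : chi2 D g != 0.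
Proof.
apply/eqP => e; have := chi2_1 D; rewrite -(mulgV g) chi2M e mul0r.
by apply/eqP; rewrite eq_sym oner_neq0.
Qed.

Lemma Hext_Zl c k x y : Hext c (k *: x) y = k * Hext c x y.
Proof.
rewrite /Hext mulr_sumr; apply: eq_bigr => i _; rewrite mulr_sumr.
by apply: eq_bigr => j _; rewrite coefZ !mulrA.
Qed.

Lemma Hext_expand c (x y : A) :
  Hext c x y = \sum_i \sum_j coef x i * coef y j * Hext c (bas i) (bas j).
Proof.
by apply: eq_bigr => i _; apply: eq_bigr => j _; rewrite Hext_bas.
Qed.

Lemma Hext_Hbilinear c (x y : A) g h :
  Hext c (grp g * x) (y * grp h) = Hext c x y.
Proof.
have [Bl Br] := Hext_bilinear c.
have Sl (F : bidx D -> A) (k : bidx D -> K) v :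
    Hext c (\sum_i k i *: F i) v = \sum_i k i * Hext c (F i) v.
  pose f u := Hext c u v.
  have f0 : f 0 = 0 by rewrite /f -(scale0r (0 : A)) Hext_Zl mul0r.
  rewrite -[LHS]/(f _) (big_morph f (id1 := 0) (op1 := +%R)) //.
    by apply: eq_bigr => i _; rewrite /f Hext_Zl.
  by move=> u u'; rewrite /f -{1}(scale1r u) Bl scale1r.
have Sr (F : bidx D -> A) (k : bidx D -> K) v :
    Hext c v (\sum_i k i *: F i) = \sum_i k i * Hext c v (F i).
  pose f u := Hext c v u.
  have f0 : f 0 = 0.
    rewrite /f /Hext big1 // => i _; rewrite big1 // => j _.
    by rewrite [coef 0 j]ffunE mulr0 mul0r.
  rewrite -[LHS]/(f _) (big_morph f (id1 := 0) (op1 := +%R)) //.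
    apply: eq_bigr => i _; rewrite /f -[_ *: _]addr0 Br -/(f 0) f0 addr0 //.
  by move=> u u'; rewrite /f -{1}(scale1r u) Br scale1r.
rewrite {1}(basE x) {1}(basE y) mulr_sumr mulr_suml [RHS]Hext_expand.
under eq_bigr do rewrite -scalerAr.
rewrite Sl; apply: eq_bigr => i _.
under eq_bigr do rewrite -scalerAl.
rewrite Sr mulr_sumr; apply: eq_bigr => j _; rewrite mulrA; congr (_ * _).
case: i j => -[i1 i2] k [[j1 j2] l].
rewrite !monM /mulc mul0n muln0 !expr0 !mulr1 scale1r !add0n !addn0 Hext_Zl.
rewrite (mon_in _ (ltn_ord i1) (ltn_ord i2)).
rewrite (mon_in _ (ltn_ord j1) (ltn_ord j2)) !Hext_bas /= chi1M chi2M.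
by rewrite !exprMn !invfM; field; rewrite ?expf_neq0 ?chi1_neq0 ?chi2_neq0.
Qed.

End Presentation.

Definition total_integral (K : fieldType) (G : finGroupType)
  (h : {ffun G -> K}) : K := \sum_(g : G) h g * (g == 1%g)%:R.

Arguments alpha {K G} D a1 a2 a.

(* Main.v *)
Require Import Defs.
From mathcomp Require Import all_boot all_order all_algebra all_fingroup.
From HB Require Import structures.
From mathcomp Require Import zify ring.
From Stdlib Require Import ClassicalEpsilon.

(* For monomials X, Y the projection pi annihilates all but the grouplike middle
   factors of Delta^2 X and Delta^2 Y, so that lambda (pi (X *_alpha Y)) is the
   sum of alpha (X_1, Y_1) alpha^-1 (X_2, Y_2) over the terms in which the
   group-like element g_1^m g_2^n attached to the total degree (m, n) of X_2 and
   Y_2 is trivial. The terms of degree (0, 0) give alpha (X, Y). Both alpha and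
   its convolution inverse (a geometric series) live in the degrees generated by
   (1, 1) if a <> 0, (r_1, 0) if a_1 <> 0 and (0, r_2) if a_2 <> 0; in each of
   the four cases g_1^m g_2^n <> 1 for all the nonzero ones among them that are
   small enough to occur. When a <> 0, applying chi_1 shows that only degrees
   with r | m + n matter. *)

Set Implicit Arguments.
Unset Strict Implicit.
Unset Printing Implicit Defensive.

Import GRing.Theory.
Local Open Scope ring_scope.

(** * Convolution on the dual of a finite-dimensional coalgebra *)

Section Convolution.
(** The coalgebra has basis [J]: [d i j k] is the coefficient of [j (x) k] in the coproduct of [i],
    and [e] is the counit. Functions on [J] are the linear forms. *)
Variables (K : fieldType) (J : finType) (d : J -> J -> J -> K) (e : {ffun J -> K}).
Hypothesis d_coassoc : forall i j k l,
  \sum_s d i j s * d s k l = \sum_s d i s l * d s j k.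
Hypothesis d_counitl : forall i k, \sum_j d i j k * e j = (k == i)%:R.
Hypothesis d_counitr : forall i j, \sum_k d i j k * e k = (j == i)%:R.
Implicit Types f g h : {ffun J -> K}.

Definition cv f g : {ffun J -> K} :=
  [ffun i => \sum_j \sum_k d i j k * (f j * g k)].

Lemma cvDl f g h : cv (f + g) h = cv f h + cv g h.
Proof.
apply/ffunP => i; rewrite !ffunE -big_split; apply: eq_bigr => j _ /=.
by rewrite -big_split; apply: eq_bigr => k _ /=; rewrite ffunE; ring.
Qed.

Lemma cvDr f g h : cv f (g + h) = cv f g + cv f h.
Proof.
apply/ffunP => i; rewrite !ffunE -big_split; apply: eq_bigr => j _ /=.
by rewrite -big_split; apply: eq_bigr => k _ /=; rewrite ffunE; ring.
Qed.

Lemma cvBr f g h : cv f (g - h) = cv f g - cv f h.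
Proof. by apply/eqP; rewrite eq_sym subr_eq -cvDr subrK. Qed.

Lemma cv1f f : cv e f = f.
Proof.
apply/ffunP => i; rewrite ffunE exchange_big (bigD1 i) //= [X in _ + X]big1.
  under eq_bigr do rewrite mulrA.
  by rewrite -mulr_suml d_counitl eqxx mul1r addr0.
move=> k ki; under eq_bigr do rewrite mulrA.
by rewrite -mulr_suml d_counitl (negPf ki) mul0r.
Qed.

Lemma cvf1 f : cv f e = f.
Proof.
apply/ffunP => i; rewrite ffunE (bigD1 i) //= [X in _ + X]big1.
  under eq_bigr do rewrite mulrCA.
  by rewrite -mulr_sumr d_counitr eqxx mulr1 addr0.
move=> j ji; under eq_bigr do rewrite mulrCA.
by rewrite -mulr_sumr d_counitr (negPf ji) mulr0.
Qed.

Lemma cvA f g h : cv f (cv g h) = cv (cv f g) h.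
Proof.
apply/ffunP => i; rewrite !ffunE.
transitivity (\sum_j \sum_k \sum_l (\sum_s d i j s * d s k l) * (f j * g k * h l)).
  apply: eq_bigr => j _.
  transitivity (\sum_s \sum_k \sum_l d i j s * d s k l * (f j * g k * h l)).
    apply: eq_bigr => s _; rewrite ffunE !mulr_sumr; apply: eq_bigr => k _.
    by rewrite !mulr_sumr; apply: eq_bigr => l _; ring.
  rewrite exchange_big; apply: eq_bigr => k _; rewrite exchange_big.
  by apply: eq_bigr => l _; rewrite mulr_suml.
transitivity (\sum_s \sum_l \sum_j \sum_k d i s l * d s j k * (f j * g k * h l)).
  under [RHS]eq_bigr do rewrite exchange_big.
  rewrite [RHS]exchange_big; apply: eq_bigr => j _.
  under [RHS]eq_bigr do rewrite exchange_big.
  rewrite [RHS]exchange_big; apply: eq_bigr => k _.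
  rewrite [RHS]exchange_big; apply: eq_bigr => l _.
  by rewrite d_coassoc mulr_suml.
apply: eq_bigr => s _; apply: eq_bigr => l _.
rewrite ffunE mulr_suml mulr_sumr; apply: eq_bigr => j _.
by rewrite mulr_suml mulr_sumr; apply: eq_bigr => k _; ring.
Qed.

Lemma cv_neq0 f g i : cv f g i != 0 ->
  exists j k, [/\ d i j k != 0, f j != 0 & g k != 0].
Proof.
rewrite ffunE => /eqP nz.
case: (boolP [exists j, exists k, [&& d i j k != 0, f j != 0 & g k != 0]]).
  by move=> /existsP[j /existsP[k /and3P[*]]]; exists j, k.
rewrite negb_exists => /forallP H; case: nz; apply: big1 => j _.
have := H j; rewrite negb_exists => /forallP{}H; apply: big1 => k _.
have := H k; rewrite !negb_and !negbK.
by case/or3P => /eqP ->; rewrite ?(mul0r, mulr0).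
Qed.

(** * Forms that differ from the counit in positive height only *)

Variables (P : J -> Prop) (ht : J -> nat).
Hypothesis P_d : forall i j k, d i j k != 0 -> P j -> P k -> P i.
Hypothesis ht_d : forall i j k, d i j k != 0 -> ht i = (ht j + ht k)%N.
Hypothesis P_ht : forall i, P i -> (0 < ht i)%N.

(** The difference [f - e] is supported on [P], where heights are positive and additive, so it is
    nilpotent for convolution. *)
Definition unipotent f := forall i, f i != e i -> P i.

Lemma unipotentB f i : unipotent f -> (f - e) i != 0 -> P i.
Proof. by move=> uf; rewrite !ffunE subr_eq0; apply: uf. Qed.

(** Expand [f * g] as [e + (f - e) + (g - e) + (f - e) * (g - e)]; the last term stays in [P] by
    [P_d]. *)
Lemma unipotent_cv f g : unipotent f -> unipotent g -> unipotent (cv f g).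
Proof.
move=> uf ug i.
have -> : cv f g = e + ((f - e) + (g - e) + cv (f - e) (g - e)).
  have {1}-> : cv f g = cv (f - e) g + g by rewrite -{3}[g]cv1f -cvDl subrK.
  rewrite cvBr cvf1; set w := cv (f - e) g.
  by apply/ffunP => j; rewrite !ffunE; ring.
rewrite [X in X != _]ffunE -subr_eq0 addrAC subrr add0r => nz.
case: (eqVneq ((f - e) i) 0) => [fi|/(unipotentB uf)//].
case: (eqVneq ((g - e) i) 0) => [gi|/(unipotentB ug)//].
move: nz; rewrite ffunE [X in X + _]ffunE fi gi !add0r => /cv_neq0[j [k [dn uj uk]]].
exact: P_d dn (unipotentB uf uj) (unipotentB ug uk).
Qed.

(* The partial sums of the geometric series of [e - f] stabilise, since [e - f]
   has positive height. *)
Lemma unipotent_rinv f : unipotent f -> exists2 g, unipotent g & cv f g = e.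
Proof.
(* [b n] is the sum of the convolution powers of [- u] with exponents [0] to [n]. *)
move=> uf; pose u := f - e; pose b n := iter n (fun b => e - cv u b) e.
have bS n : b n.+1 = e - cv u (b n) by [].
have ub n : unipotent (b n).
  elim: n => [|n IHn] i; first by rewrite eqxx.
  rewrite bS ffunE -subr_eq0 addrAC subrr add0r ffunE oppr_eq0.
  rewrite -[b n](subrK e) cvDr cvf1 ffunE => nz.
  case: (eqVneq (u i) 0) => [ui|/(unipotentB uf)//].
  move: nz; rewrite ui addr0 => /cv_neq0[j [k [dn uj uk]]].
  exact: P_d dn (unipotentB uf uj) (unipotentB IHn uk).
(* The difference is the power of [- u] with exponent [n.+1]; each factor takes up at least one unit
   of height. *)
have small n i : (ht i <= n)%N -> (b n.+1 - b n) i = 0.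
  elim: n i => [|n IHn] i hi.
    apply/eqP; rewrite bS addrAC subrr add0r cvf1 ffunE oppr_eq0.
    by apply: contraT => /(unipotentB uf) /P_ht; lia.
  have -> : b n.+2 - b n.+1 = - cv u (b n.+1 - b n).
    by rewrite cvBr [b n.+2]bS [X in _ - X]bS !opprD addrACA subrr add0r.
  apply/eqP; rewrite ffunE oppr_eq0.
  apply: contraT => /cv_neq0[j [k [dn /(unipotentB uf)/P_ht hj]]].
  by rewrite IHn ?eqxx //; have := ht_d dn; lia.
pose N := \max_i ht i; exists (b N) => //.
have -> : cv f (b N) = e - (b N.+1 - b N).
  rewrite -{1}[f](subrK e) cvDl cv1f -/u bS !opprB addrCA.
  by rewrite [e + _]addrC subrK addrC.
apply/ffunP => i; rewrite ffunE [X in _ + X]ffunE small ?subr0 //.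
exact: leq_bigmax.
Qed.

(** The right inverse of [f] is unipotent too, so it has a right inverse of its own, which
    associativity identifies with [f]. *)
Lemma unipotent_inv f : unipotent f ->
  exists g, [/\ unipotent g, cv f g = e & cv g f = e].
Proof.
move=> /unipotent_rinv[g ug fg]; have [f' _ gf'] := unipotent_rinv ug.
exists g; split=> //; suff -> : f = f' by [].
by rewrite -[f]cvf1 -gf' cvA fg cv1f.
Qed.

End Convolution.

(** * The q-binomial theorem *)

Section QBinomial.
Variables (K : fieldType) (q : K).

(** Gaussian binomials by the q-Pascal rule, which avoids division and so makes sense at roots of
    unity. *)
Fixpoint qbin (n k : nat) : K :=
  match n, k with
  | _, 0%N => 1
  | 0%N, _.+1 => 0
  | n'.+1, k'.+1 => qbin n' k' + q ^+ k'.+1 * qbin n' k'.+1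
  end.

Lemma qbin0 n : qbin n 0 = 1. Proof. by case: n. Qed.

Lemma qbin_small n k : (n < k)%N -> qbin n k = 0.
Proof.
elim: n k => [|n IHn] [|k] //= h.
by rewrite !IHn ?mulr0 ?addr0 //; lia.
Qed.

Lemma qbinn n : qbin n n = 1.
Proof. by elim: n => //= n ->; rewrite qbin_small ?mulr0 ?addr0. Qed.

Lemma qfactS m : qfact q m.+1 = qfact q m * \sum_(j < m.+1) q ^+ j.
Proof. by rewrite /qfact big_nat_recr. Qed.

Lemma qfact0 : qfact q 0 = 1. Proof. by rewrite /qfact big_geq. Qed.

(** With [[m] = 1 + q + ... + q^(m-1)], the inductive step splits [[k + l + 2]] as [[k + 1] +
    q^(k+1) [l + 1]]. *)
Lemma qbin_fact k l : qbin (k + l) k * (qfact q k * qfact q l) = qfact q (k + l).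
Proof.
elim: k l => [|k IHk] l; first by rewrite qbin0 qfact0 !mul1r.
elim: l => [|l IHl].
  rewrite addn0 /= (@qbin_small k k.+1) // mulr0 addr0 qfact0 mulr1 qfactS.
  by have := IHk 0%N; rewrite addn0 qfact0 mulr1 mulrA => ->.
rewrite [in LHS]addSn [qbin _ _]/=.
have := IHk l.+1; have := IHl; rewrite addSnnS => E1 E2.
transitivity (qfact q (k + l.+1) * \sum_(j < k.+1) q ^+ j
  + qfact q (k + l.+1) * (q ^+ k.+1 * \sum_(j < l.+1) q ^+ j)).
  by rewrite -{1}E2 -E1 !qfactS; ring.
rewrite -mulrDr addSn qfactS; congr (_ * _).
rewrite -addSn big_split_ord /= mulr_sumr; congr (_ + _).
by apply: eq_bigr => j _; rewrite exprD.
Qed.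

(** A vanishing factor [1 + q + ... + q^m] would give [q^(m+1) = 1], which is impossible below the
    order of [q]. *)
Lemma qfact_neq0 r m : r.-primitive_root q -> (m < r)%N -> qfact q m != 0.
Proof.
move=> qr; elim: m => [|m IHm] mr; first by rewrite qfact0 oner_neq0.
rewrite qfactS; apply: mulf_neq0; first by apply: IHm; lia.
apply/eqP => s0; have := subrX1 q m.+1; rewrite s0 mulr0 => /eqP.
by rewrite subr_eq0 -(prim_order_dvd qr) => /dvdn_leq; lia.
Qed.

(** Both sides are the q-trinomial coefficient, as seen after multiplying by the quantum factorials,
    which are nonzero below [r]. This is the arithmetic behind coassociativity. *)
Lemma qbin_assoc r i j l : r.-primitive_root q -> (i + j + l < r)%N ->
  qbin (i + j + l) (i + j) * qbin (i + j) i = qbin (i + (j + l)) i * qbin (j + l) j.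
Proof.
move=> qr lr; have nz m : (m <= i + j + l)%N -> qfact q m != 0.
  by move=> h; apply: qfact_neq0 qr _; lia.
have nz3 : qfact q i * qfact q j * qfact q l != 0.
  by rewrite !mulf_neq0 ?nz //; lia.
have nij : qfact q (i + j) != 0 by rewrite nz //; lia.
have njl : qfact q (j + l) != 0 by rewrite nz //; lia.
apply: (mulIf nz3).
transitivity (qfact q (i + j + l)).
  by rewrite -[RHS]qbin_fact -[qfact q (i + j)]qbin_fact; ring.
by rewrite -addnA -[LHS]qbin_fact -[qfact q (j + l)]qbin_fact; ring.
Qed.

(** The q-binomial theorem for an operator: [f] is a sum of two q-commuting letters, and [T k l] is
    the ordered word with [k] of the first and [l] of the second. *)
Lemma iter_qbin (V : lmodType K) (f : {linear V -> V}) (T : nat -> nat -> V) n :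
  (forall k l, f (T k l) = T k.+1 l + q ^+ k *: T k l.+1) ->
  iter n f (T 0 0) = \sum_(k < n.+1) qbin n k *: T k (n - k)%N.
Proof.
move=> fT; elim: n => [|n IHn]; first by rewrite big_ord1 /= scale1r.
rewrite iterS IHn linear_sum /=.
under eq_bigr do rewrite linearZ /= fT scalerDr scalerA.
rewrite big_split /= [RHS]big_ord_recl /= scale1r.
under [X in _ = _ + X]eq_bigr do rewrite /bump /= add1n subSS scalerDl.
rewrite big_split /= addrCA; congr (_ + _).
rewrite big_ord_recl /= qbin0 mul1r expr0 scale1r subn0; congr (_ + _).
rewrite [RHS]big_ord_recr /= qbin_small // mulr0 scale0r addr0.
apply: eq_bigr => k _; rewrite /bump /= add1n mulrC.
by rewrite subnSK.
Qed.

End QBinomial.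

(** * The structure constants of the coproduct of A *)

Section Coproduct.
Variables (K : fieldType) (G : finGroupType) (D : quantum_plane K G).
Local Notation A := (biproduct D).
Local Notation I := (bidx D).
Local Notation A2 := {ffun I * I -> K^o}.
Local Notation q1 := (chi1 D (g1 D)).
Local Notation q2 := (chi2 D (g2 D)).
Local Notation p12 := (chi2 D (g1 D)).

Lemma tmul_linear (s : A2) : linear (@tmul K G D s).
Proof.
move=> c t t'; rewrite /tmul scaler_sumr -big_split; apply: eq_bigr => p _ /=.
rewrite scaler_sumr -big_split; apply: eq_bigr => q _ /=.
rewrite !ffunE scalerA -scalerDl; congr (_ *: _).
by rewrite /GRing.scale /=; ring.
Qed.

HB.instance Definition _ s :=
  GRing.isLinear.Build K A2 A2 *:%R (@tmul K G D s) (tmul_linear s).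

Lemma tensZl c (x y : A) : tens (c *: x) y = c *: tens x y.
Proof. by apply/ffunP => p; rewrite !ffunE Defs.coefZ -mulrA. Qed.

Lemma iter_linear (V : lmodType K) (f : {linear V -> V}) n (J : finType)
    (c : J -> K) (v : J -> V) :
  iter n f (\sum_j c j *: v j) = \sum_j c j *: iter n f (v j).
Proof.
elim: n => [//|n IHn]; rewrite iterS IHn linear_sum.
by apply: eq_bigr => j _; rewrite linearZ.
Qed.

(** The q-binomial theorem is applied to the powers of [Delta_x2], then to those of [Delta_x1]. *)
Lemma Delta_mon_sum n1 n2 g : (n1 < r1 D)%N -> (n2 < r2 D)%N ->
  Delta (mon D n1 n2 g) = \sum_(k2 < n2.+1) \sum_(k1 < n1.+1)
    (qbin q2 n2 k2 * (qbin q1 n1 k1 * p12 ^+ (k2 * (n1 - k1)))) *: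
      tens (mon D k1 k2 (g1 D ^+ (n1 - k1) * (g2 D ^+ (n2 - k2) * g))%g)
           (mon D (n1 - k1) (n2 - k2) g).
Proof.
move=> h1 h2; rewrite Delta_mon //.
(* The word with [k] letters [x_2 (x) 1] followed by [l] letters [g_2 (x) x_2]. Moving [g_2] past
   [x_2^k] produces [q2 ^+ k]. *)
pose T k l : A2 := tens (mon D 0 k (g2 D ^+ l * g)%g) (mon D 0 l g).
have -> : tens (grp D g) (grp D g) = T 0 0 by rewrite /T expg0 mul1g.
rewrite (iter_qbin (q := q2)) => [|k l]; last first.
  rewrite /T /= /Delta_x2 tmulDl !tmul_tens !monM /mulc chi1_1 chi2_1 !expr1n.
  rewrite !expr0 ?mul0n ?muln0 ?expr0 ?mulr1 ?mul1r !scale1r !mul1g !add1n !add0n.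
  by rewrite tensZl mulgA -expgS.
rewrite iter_linear; apply: eq_bigr => k2 _.
(* The same with [x_1]; the power of [p12] comes from moving [g_1^l] past [x_2^k2]. *)
pose T' k l : A2 := p12 ^+ (k2 * l) *:
  tens (mon D k k2 (g1 D ^+ l * (g2 D ^+ (n2 - k2) * g))%g) (mon D l (n2 - k2) g).
have -> : T k2 (n2 - k2)%N = T' 0 0 by rewrite /T /T' muln0 expr0 scale1r expg0 mul1g.
rewrite (iter_qbin (q := q1)) => [|k l]; last first.
  rewrite /T' linearZ /Delta_x1 [LHS]/= tmulDl !tmul_tens !monM /mulc.
  rewrite chi1_1 chi2_1 !expr1n !expr0 ?mul0n ?muln0 ?expr0 ?mulr1 ?mul1r !scale1r !mul1g.
  rewrite !add1n !add0n scalerDr tensZl expgS -!mulgA !scalerA; congr (_ + _ *: _).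
  by rewrite mulnS exprD; ring.
rewrite scaler_sumr; apply: eq_bigr => k1 _.
by rewrite /T' !scalerA mulrA.
Qed.

(* The grouplike that appears in the left factor of [Delta] opposite
   [x_1^n1 x_2^n2]. *)
Definition gdeg (n1 n2 : nat) : G := (g1 D ^+ n1 * g2 D ^+ n2)%g.

Definition dcoef (i j k : I) : K := Delta (bas i) (j, k).

Lemma dcoefE i j k : dcoef i j k =
  if [&& i.1.1 == (j.1.1 + k.1.1)%N :> nat, i.1.2 == (j.1.2 + k.1.2)%N :> nat,
         j.2 == (gdeg k.1.1 k.1.2 * i.2)%g & k.2 == i.2]
  then qbin q2 i.1.2 j.1.2 * (qbin q1 i.1.1 j.1.1 * p12 ^+ (j.1.2 * k.1.1))
  else 0.
Proof.
rewrite /dcoef Delta_mon_sum ?ltn_ord // sum_ffunE.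
case: i j k => -[[i1 hi1] [i2 hi2]] g [[[j1 hj1] [j2 hj2]] gj] [[[k1 hk1] [k2 hk2]] gk] /=.
case: ifP => [/and4P[/eqP e1 /eqP e2 /eqP eg /eqP eh]|nC].
  have lt2 : (j2 < i2.+1)%N by lia.
  have lt1 : (j1 < i1.+1)%N by lia.
  rewrite (bigD1 (Ordinal lt2)) //= [X in _ + X]big1 => [|l nl]; last first.
    rewrite sum_ffunE big1 // => l' _; rewrite !ffunE !coef_mon /=.
    have -> : (j2 == l) = false by apply: contraNF nl => /eqP ?; apply/eqP/val_inj.
    by rewrite andbF /= mul0r scaler0.
  rewrite sum_ffunE addr0 (bigD1 (Ordinal lt1)) //= [X in _ + X]big1 => [|l nl]; last first.
    rewrite !ffunE !coef_mon /=.
    have -> : (j1 == l) = false by apply: contraNF nl => /eqP ?; apply/eqP/val_inj.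
    by rewrite /= mul0r scaler0.
  rewrite !ffunE !coef_mon /= e1 e2 !addKn eg eh /gdeg mulgA !eqxx /=.
  by rewrite mulr1 addr0 /GRing.scale /= mulr1.
rewrite big1 // => -[l2 hl2] _; rewrite sum_ffunE big1 // => -[l1 hl1] _ /=.
rewrite !ffunE !coef_mon /=.
case: eqP => [e1|_]; last by rewrite mul0r scaler0.
case: eqP => [e2|_]; last by rewrite mul0r scaler0.
case: eqP => [eg|_]; last by rewrite mul0r scaler0.
case: eqP => [e3|_]; last by rewrite mulr0 scaler0.
case: eqP => [e4|_]; last by rewrite mulr0 scaler0.
case: eqP => [eh|_]; last by rewrite mulr0 scaler0.
case/negP: nC; rewrite eg eh e3 e4 /gdeg mulgA !eqxx !andbT.
by apply/andP; split; apply/eqP; lia.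
Qed.

Lemma bidx_eq (i j : I) :
  (i == j) = [&& i.1.1 == j.1.1 :> nat, i.1.2 == j.1.2 :> nat & i.2 == j.2].
Proof. by case: i j => [[i1 i2] g] [[j1 j2] h] /=; rewrite andbA. Qed.

Lemma dcoef_counitl i k :
  \sum_j dcoef i j k * ((j.1.1 == 0 :> nat) && (j.1.2 == 0 :> nat))%:R = (k == i)%:R.
Proof.
pose j0 : I := (Ordinal (ltnW (r1_ge2 D)), Ordinal (ltnW (r2_ge2 D)),
  (gdeg k.1.1 k.1.2 * i.2)%g).
rewrite (bigD1 j0) //= big1 ?addr0 => [|j]; last first.
  rewrite bidx_eq /= dcoefE; case: ifP => [/and4P[_ _ -> _]|]; last by rewrite mul0r.
  by case: (_ == 0%N) => //; case: (_ == 0%N) => //; rewrite mulr0.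
rewrite mulr1 dcoefE /= !add0n !qbin0 eqxx mul0n expr0 !mulr1 bidx_eq.
by rewrite /= (eq_sym (i.1.1 : nat)) (eq_sym (i.1.2 : nat)); case: ifP.
Qed.

Lemma dcoef_counitr i j :
  \sum_k dcoef i j k * ((k.1.1 == 0 :> nat) && (k.1.2 == 0 :> nat))%:R = (j == i)%:R.
Proof.
pose k0 : I := (Ordinal (ltnW (r1_ge2 D)), Ordinal (ltnW (r2_ge2 D)), i.2).
rewrite (bigD1 k0) //= big1 ?addr0 => [|k]; last first.
  rewrite bidx_eq /= dcoefE; case: ifP => [/and4P[_ _ _ ->]|]; last by rewrite mul0r.
  by case: (_ == 0%N) => //; case: (_ == 0%N) => //; rewrite mulr0.
rewrite mulr1 dcoefE /= !addn0 eqxx muln0 expr0 !mulr1 bidx_eq /gdeg !expg0 !mul1g andbT.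
rewrite (eq_sym (i.1.1 : nat)) (eq_sym (i.1.2 : nat)).
case: ifP => // /and3P[/eqP -> /eqP -> _].
by rewrite !qbinn mulr1.
Qed.

Hypothesis abG : abelian [set: G].

Lemma mulgC_ab (g h : G) : (g * h = h * g)%g.
Proof. by apply: (centsP abG); rewrite inE. Qed.

Lemma gdegD m1 m2 n1 n2 : gdeg (m1 + n1) (m2 + n2) = (gdeg m1 m2 * gdeg n1 n2)%g.
Proof.
rewrite /gdeg !expgD -!mulgA; congr (_ * _)%g.
by rewrite !mulgA; congr (_ * _)%g; apply: mulgC_ab.
Qed.

(** Degrees and group parts determine the intermediate index, so each side has at most one nonzero
    term. The two terms agree by [qbin_assoc] in each variable, the exponents of [p12] being
    biadditive. *)
Lemma dcoef_coassoc i j k l :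
  \sum_s dcoef i j s * dcoef s k l = \sum_s dcoef i s l * dcoef s j k.
Proof.
(* The condition for [j (x) k (x) l] to be compatible with [i]; without it every term on both sides
   vanishes. *)
pose C := [&& i.1.1 == (j.1.1 + k.1.1 + l.1.1)%N :> nat,
  i.1.2 == (j.1.2 + k.1.2 + l.1.2)%N :> nat, l.2 == i.2,
  k.2 == (gdeg l.1.1 l.1.2 * i.2)%g
  & j.2 == (gdeg k.1.1 k.1.2 * (gdeg l.1.1 l.1.2 * i.2))%g].
have [/and5P[/eqP e1 /eqP e2 /eqP el /eqP ek /eqP ej]|nC] := boolP C; last first.
  rewrite !big1 // => s _; rewrite !dcoefE.
    case: ifP => [/and4P[/eqP e1 /eqP e2 /eqP e3 /eqP e4]|]; last by rewrite mul0r.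
    case: ifP => [/and4P[/eqP e5 /eqP e6 /eqP e7 /eqP e8]|]; last by rewrite mulr0.
    by case/negP: nC; rewrite /C e1 e2 e5 e6 e8 e7 e3 e4 !eqxx.
  case: ifP => [/and4P[/eqP e1 /eqP e2 /eqP e3 /eqP e4]|]; last by rewrite mul0r.
  case: ifP => [/and4P[/eqP e5 /eqP e6 /eqP e7 /eqP e8]|]; last by rewrite mulr0.
  by case/negP: nC; rewrite /C e1 e2 e5 e6 e8 e7 e3 e4 e5 e6 gdegD
    (mulgA (gdeg k.1.1 k.1.2) (gdeg _ _)) !addnA !eqxx.
have hi1 := ltn_ord i.1.1; have hi2 := ltn_ord i.1.2.
have ht1 : (k.1.1 + l.1.1 < r1 D)%N by lia.
have ht2 : (k.1.2 + l.1.2 < r2 D)%N by lia.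
have hu1 : (j.1.1 + k.1.1 < r1 D)%N by lia.
have hu2 : (j.1.2 + k.1.2 < r2 D)%N by lia.
(* [t] and [u] are the only intermediate indices that survive on the left and on the right. *)
pose t : I := (Ordinal ht1, Ordinal ht2, i.2).
pose u : I := (Ordinal hu1, Ordinal hu2, (gdeg l.1.1 l.1.2 * i.2)%g).
rewrite (bigD1 t) //= [X in _ + X]big1 => [|s]; last first.
  rewrite bidx_eq !dcoefE /= => ns.
  case: ifP => [/and4P[_ _ _ e4]|]; last by rewrite mul0r.
  case: ifP => [/and4P[e5 e6 _ _]|]; last by rewrite mulr0.
  by rewrite e4 e5 e6 in ns.
rewrite (bigD1 u) //= [X in _ = _ + X]big1 => [|s]; last first.
  rewrite bidx_eq !dcoefE /= => ns.
  case: ifP => [/and4P[_ _ e4 _]|]; last by rewrite mul0r.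
  case: ifP => [/and4P[e5 e6 _ _]|]; last by rewrite mulr0.
  by rewrite e4 e5 e6 in ns.
rewrite !addr0 !dcoefE /= gdegD ej ek el (mulgA (gdeg k.1.1 k.1.2) (gdeg _ _)).
rewrite e1 e2 !addnA !eqxx /=.
have A1 := qbin_assoc (chi1_prim D) (i := j.1.1) (j := k.1.1) (l := l.1.1).
have A2 := qbin_assoc (chi2_prim D) (i := j.1.2) (j := k.1.2) (l := l.1.2).
rewrite -e1 in A1; rewrite -e2 in A2.
move: (A1 hi1) (A2 hi2); rewrite e1 e2 !addnA => {}A1 {}A2.
rewrite !mulnDr !mulnDl !exprD.
transitivity (qbin q2 (j.1.2 + k.1.2 + l.1.2) j.1.2 * qbin q2 (k.1.2 + l.1.2) k.1.2 *
  (qbin q1 (j.1.1 + k.1.1 + l.1.1) j.1.1 * qbin q1 (k.1.1 + l.1.1) k.1.1) *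
  (p12 ^+ (j.1.2 * k.1.1) * p12 ^+ (j.1.2 * l.1.1) * p12 ^+ (k.1.2 * l.1.1))).
  by ring.
by rewrite -A1 -A2; ring.
Qed.

End Coproduct.

(** * Forms on A (x) A *)

Section Forms.
Variables (K : fieldType) (G : finGroupType) (D : quantum_plane K G).
Hypothesis abG : abelian [set: G].
Local Notation A := (biproduct D).
Local Notation I := (bidx D).
Implicit Types (f g : Defs.form D) (i j : I) (u v w : I * I).

Lemma sum_prod (V : nmodType) (T U : finType) (F : T * U -> V) :
  \sum_p F p = \sum_a \sum_b F (a, b).
Proof. by rewrite pair_bigA; apply: eq_bigr => -[]. Qed.

Definition dcoef2 u v w : K := dcoef u.1 v.1 w.1 * dcoef u.2 v.2 w.2.

Definition eps_b i : K := ((i.1.1 == 0 :> nat) && (i.1.2 == 0 :> nat))%:R.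

(** Passing to values on the basis turns a form into an element of the dual of [A (x) A], where
    [fconv] becomes [cv dcoef2]. *)
Definition form_ffun f : {ffun I * I -> K} := [ffun u => f (bas u.1) (bas u.2)].

Definition eps2_b := form_ffun (@eps2 K G D).

Lemma eps2_bE u : eps2_b u = eps_b u.1 * eps_b u.2.
Proof. by rewrite ffunE /eps2 /bas !counit_mon. Qed.

Lemma eps2_b_neq0 u : eps2_b u != 0 -> eps2_b u = 1 /\
  [/\ u.1.1.1 = 0 :> nat, u.1.1.2 = 0 :> nat, u.2.1.1 = 0 :> nat & u.2.1.2 = 0 :> nat].
Proof.
rewrite eps2_bE /eps_b -natrM mulnb.
by case: andP => [[/andP[/eqP-> /eqP->] /andP[/eqP-> /eqP->]]|_]; rewrite ?eqxx.
Qed.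

Lemma dcoef2_coassoc u v w x :
  \sum_s dcoef2 u v s * dcoef2 s w x = \sum_s dcoef2 u s x * dcoef2 s v w.
Proof.
rewrite [LHS]sum_prod [RHS]sum_prod /dcoef2 /=.
under eq_bigr do under eq_bigr do rewrite mulrACA.
under [RHS]eq_bigr do under eq_bigr do rewrite mulrACA.
by rewrite -!big_distrlr /= !(dcoef_coassoc abG).
Qed.

Lemma dcoef2_counitl u w : \sum_v dcoef2 u v w * eps2_b v = (w == u)%:R.
Proof.
rewrite sum_prod; under eq_bigr do under eq_bigr do rewrite eps2_bE /dcoef2 /= mulrACA.
rewrite -big_distrlr /= !dcoef_counitl -natrM mulnb.
by case: u w => [u1 u2] [].
Qed.

Lemma dcoef2_counitr u v : \sum_w dcoef2 u v w * eps2_b w = (v == u)%:R.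
Proof.
rewrite sum_prod; under eq_bigr do under eq_bigr do rewrite eps2_bE /dcoef2 /= mulrACA.
rewrite -big_distrlr /= !dcoef_counitr -natrM mulnb.
by case: u v => [u1 u2] [].
Qed.

Lemma dcoef2_neq0 u v w : dcoef2 u v w != 0 -> [/\
  [/\ u.1.1.1 = v.1.1.1 + w.1.1.1 :> nat, u.1.1.2 = v.1.1.2 + w.1.1.2 :> nat,
      u.2.1.1 = v.2.1.1 + w.2.1.1 :> nat & u.2.1.2 = v.2.1.2 + w.2.1.2 :> nat]%N,
  v.1.2 = (gdeg D w.1.1.1 w.1.1.2 * u.1.2)%g,
  v.2.2 = (gdeg D w.2.1.1 w.2.1.2 * u.2.2)%g & w.1.2 = u.1.2 /\ w.2.2 = u.2.2].
Proof.
rewrite mulf_eq0 negb_or !dcoefE => /andP[].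
case: ifP => [/and4P[/eqP-> /eqP-> /eqP-> /eqP->] _|]; last by rewrite eqxx.
by case: ifP => [/and4P[/eqP-> /eqP-> /eqP-> /eqP->] _|]; last by rewrite eqxx.
Qed.

Lemma form_ffun_conv (E F : lmodType K) (op : E -> F -> K^o)
    (f : A -> A -> E) (g : A -> A -> F) :
  form_ffun (conv op f g) = [ffun u => \sum_v \sum_w
    dcoef2 u v w * op (f (bas v.1) (bas v.2)) (g (bas w.1) (bas w.2))].
Proof.
apply/ffunP => u; rewrite !ffunE /conv [LHS]sum_prod [RHS]sum_prod; apply: eq_bigr => a _.
under eq_bigr do rewrite sum_prod; rewrite exchange_big; apply: eq_bigr => b _.
by rewrite [RHS]sum_prod.
Qed.

Lemma form_ffun_fconv f g :
  form_ffun (fconv f g) = cv dcoef2 (form_ffun f) (form_ffun g).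
Proof.
rewrite /fconv form_ffun_conv; apply/ffunP => u; rewrite !ffunE.
by apply: eq_bigr => v _; apply: eq_bigr => w _; rewrite !ffunE.
Qed.

Lemma Delta_linear : linear (@Delta K G D).
Proof.
move=> c x y; rewrite /Delta scaler_sumr -big_split; apply: eq_bigr => i _ /=.
by rewrite scalerA -scalerDl Defs.coefD Defs.coefZ.
Qed.

Lemma counit_linear : linear (@counit K G D : A -> K^o).
Proof.
move=> c x y; rewrite /counit scaler_sumr -big_split; apply: eq_bigr => i _ /=.
by rewrite Defs.coefD Defs.coefZ mulrDl /GRing.scale /= mulrA.
Qed.

Lemma conv_bilinear (E F H : lmodType K) (op : E -> F -> H)
    (f : A -> A -> E) (g : A -> A -> F) :
  bilinear_map (conv (D := D) op f g).
Proof.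
split=> [c x x' y|c x y y']; rewrite /conv scaler_sumr -big_split;
  apply: eq_bigr => p _ /=; rewrite scaler_sumr -big_split; apply: eq_bigr => q _ /=;
  rewrite scalerA -scalerDl Delta_linear !ffunE; congr (_ *: _).
  by rewrite /GRing.scale /=; ring.
by rewrite /GRing.scale /=; ring.
Qed.

Lemma eps2_bilinear : bilinear_map (@eps2 K G D).
Proof.
split=> c x y z; rewrite /eps2 counit_linear.
  by rewrite mulrDl scalerAl.
by rewrite mulrDr scalerAr.
Qed.

Lemma bilinear_sum (E : lmodType K) (f : A -> A -> E) (S T : finType)
    (c : S -> K) (d : T -> K) (x : S -> A) (y : T -> A) : bilinear_map f ->
  f (\sum_s c s *: x s) (\sum_t d t *: y t) =
  \sum_s \sum_t (c s * d t) *: f (x s) (y t).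
Proof.
move=> [fl fr].
have f0y z : f 0 z = 0.
  by have := fl (-1) 0 0 z; rewrite scaler0 addr0 scaleN1r addNr.
have fx0 z : f z 0 = 0.
  by have := fr (-1) z 0 0; rewrite scaler0 addr0 scaleN1r addNr.
have -> z : f (\sum_s c s *: x s) z = \sum_s c s *: f (x s) z.
  apply: (big_ind2 (fun a b => f a z = b)) => // [u u' v v' <- <-|s _].
    by rewrite -{1}[u]scale1r fl scale1r.
  by rewrite -[_ *: x s]addr0 fl f0y addr0.
apply: eq_bigr => s _.
have -> z : f z (\sum_t d t *: y t) = \sum_t d t *: f z (y t).
  apply: (big_ind2 (fun a b => f z a = b)) => // [u u' v v' <- <-|t _].
    by rewrite -{1}[u]scale1r fr scale1r.
  by rewrite -[_ *: y t]addr0 fr fx0 addr0.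
by rewrite scaler_sumr; apply: eq_bigr => t _; rewrite scalerA.
Qed.

Lemma bilinear_ext f g : bilinear_map f -> bilinear_map g ->
  form_ffun f = form_ffun g -> forall x y, f x y = g x y.
Proof.
move=> bf bg fg x y; rewrite (basE x) (basE y) !bilinear_sum //.
apply: eq_bigr => i _; apply: eq_bigr => j _.
by have /ffunP/(_ (i, j)) := fg; rewrite !ffunE /= => ->.
Qed.

(** * Forms that differ from the counit only in prescribed bidegrees *)

Variable Q : nat -> nat -> Prop.
Hypothesis Q_add : forall m n m' n', Q m n -> Q m' n' -> Q (m + m') (n + n').
Hypothesis Q_pos : forall m n, Q m n -> (0 < m + n)%N.

(** The degrees of both tensor factors are added, since the product of the two grouplikes attached
    to them depends only on the sum. *)
Definition tdeg_in u := Q (u.1.1.1 + u.2.1.1) (u.1.1.2 + u.2.1.2).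

Local Notation unip := (unipotent eps2_b tdeg_in).

Lemma tdeg_in_d u v w : dcoef2 u v w != 0 -> tdeg_in v -> tdeg_in w -> tdeg_in u.
Proof.
move=> /dcoef2_neq0[[e1 e2 e3 e4] _ _ _] Qv Qw; have := Q_add Qv Qw.
by rewrite /tdeg_in e1 e2 e3 e4 (addnACA v.1.1.1) (addnACA v.1.1.2).
Qed.

Definition tdeg u := (u.1.1.1 + u.2.1.1 + (u.1.1.2 + u.2.1.2))%N.

Lemma tdeg_d u v w : dcoef2 u v w != 0 -> tdeg u = (tdeg v + tdeg w)%N.
Proof. by move=> /dcoef2_neq0[[e1 e2 e3 e4] _ _ _]; rewrite /tdeg; lia. Qed.

Lemma unipotent_fconv f g : unip (form_ffun f) -> unip (form_ffun g) ->
  unip (form_ffun (fconv f g)).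
Proof.
rewrite form_ffun_fconv; apply: unipotent_cv.
- exact: dcoef2_counitl.
- exact: dcoef2_counitr.
- exact: tdeg_in_d.
Qed.

(** [conv_inv] is a mere choice. The bilinear extension of the geometric-series inverse shows that
    the choice is made among actual inverses, and uniqueness of inverses identifies the two. *)
Lemma unipotent_conv_inv f : unip (form_ffun f) -> unip (form_ffun (conv_inv f)).
Proof.
move=> uf.
have [h [uh fh hf]] := unipotent_inv dcoef2_coassoc dcoef2_counitl dcoef2_counitr
  tdeg_in_d tdeg_d (fun u => @Q_pos _ _) uf.
pose del : Defs.form D := fun x y => \sum_i \sum_j coef x i * coef y j * h (i, j).
have del_bil : bilinear_map del.
  split=> [c x x' y|c x y y']; rewrite /del scaler_sumr -big_split;
    apply: eq_bigr => i _ /=; rewrite scaler_sumr -big_split; apply: eq_bigr => j _ /=;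
    rewrite Defs.coefD Defs.coefZ /GRing.scale /=; ring.
have del_h : form_ffun del = h.
  apply/ffunP => -[i j]; rewrite ffunE /del /= (bigD1 i) //= (bigD1 j) //=.
  rewrite !coef_bas !eqxx !mul1r [X in _ + X + _]big1 => [|l lj]; last first.
    by rewrite !coef_bas (negPf lj) mulr0 mul0r.
  rewrite big1 ?addr0 // => k ki; rewrite big1 // => l _.
  by rewrite !coef_bas (negPf ki) !mul0r.
have del_inv : is_conv_inverse f del.
  by split=> //; apply: bilinear_ext; rewrite ?form_ffun_fconv ?del_h //;
    solve [exact: conv_bilinear | exact: eps2_bilinear].
have := epsilon_spec (inhabits (@eps2 K G D)) (is_conv_inverse f).
rewrite -/(conv_inv f) => /(_ (ex_intro _ _ del_inv))[_ _ inv_f].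
suff -> : form_ffun (conv_inv f) = h by [].
rewrite -[LHS](cvf1 dcoef2_counitr) -fh (cvA dcoef2_coassoc) -form_ffun_fconv.
have -> : form_ffun (fconv (conv_inv f) f) = eps2_b.
  by apply/ffunP => u; rewrite !ffunE inv_f.
exact: (cv1f dcoef2_counitl).
Qed.

(** The character factors in [Hext] do no harm: where [c] agrees with [eps_val], either the value is
    zero or the exponents of the characters are. *)
Lemma unipotent_Hext c :
  (forall n1 n2 m1 m2,
     c n1 n2 m1 m2 != eps_val K n1 n2 m1 m2 -> Q (n1 + m1) (n2 + m2)) ->
  unip (form_ffun (Hext c)).
Proof.
move=> cQ u; rewrite ffunE Hext_bas => nz; apply: cQ; apply: contraNneq nz => ->.
rewrite eps2_bE /eps_val /eps_b -natrM mulnb -andbA; apply/eqP.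
case: (eqVneq (u.1.1.1 : nat) 0%N) => [->|_]; last by rewrite mulr0.
case: (eqVneq (u.1.1.2 : nat) 0%N) => [->|_]; last by rewrite mulr0.
by rewrite !expr0 !invr1 !mul1r.
Qed.

(** This functional reads off the coefficient of the unit of [A]; the theorem says that it sends the
    twisted product of [x] and [y] to [alpha x y]. *)
Definition tau (x : A) : K := total_integral (Hpi x).

Lemma tauE x :
  tau x = coef x (Ordinal (ltnW (r1_ge2 D)), Ordinal (ltnW (r2_ge2 D)), 1%g).
Proof.
have cX (n : 'I_(r1 D)) (m : 'I_(r2 D)) :
    counit (x1 D ^+ n * x2 D ^+ m) = ((n == 0 :> nat) && (m == 0 :> nat))%:R.
  by have := counit_mon n m 1%g; rewrite mon_genE grp1 mulr1.
rewrite /tau /total_integral (bigD1 1%g) //= [X in _ + X]big1 => [|g /negPf->]; last first.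
  by rewrite mulr0.
rewrite eqxx mulr1 addr0 ffunE (bigD1 (Ordinal (ltnW (r1_ge2 D)))) //=.
rewrite [X in _ + X]big1 => [|n n0]; last first.
  rewrite big1 // => m _; rewrite cX.
  by rewrite -(inj_eq val_inj) /= in n0; rewrite (negPf n0) mulr0.
rewrite addr0 (bigD1 (Ordinal (ltnW (r2_ge2 D)))) //=.
rewrite [X in _ + X]big1 => [|m m0]; last first.
  rewrite (cX (Ordinal (ltnW (r1_ge2 D)))).
  by rewrite -(inj_eq val_inj) /= in m0; rewrite (negPf m0) andbF mulr0.
by rewrite (cX (Ordinal (ltnW (r1_ge2 D))) (Ordinal (ltnW (r2_ge2 D)))) mulr1 addr0.
Qed.

Lemma tau_linear : linear (tau : A -> K^o).
Proof. by move=> c x y; rewrite !tauE Defs.coefD Defs.coefZ. Qed.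

Lemma tau_mul_bas i j :
  tau (bas i * bas j) = eps_b i * eps_b j * (i.2 * j.2 == 1)%g%:R.
Proof.
rewrite tauE /bas monM Defs.coefZ coef_mon /= ![(0 == _)%N]eq_sym !addn_eq0.
rewrite /eps_b (eq_sym 1%g).
case: (eqVneq (i.1.1 : nat) 0%N) => [_|_] /=; last by rewrite !(mul0r, mulr0).
case: (eqVneq (j.1.1 : nat) 0%N) => [->|_] /=; last by rewrite !(mul0r, mulr0).
case: (eqVneq (i.1.2 : nat) 0%N) => [->|_] /=; last by rewrite !(mul0r, mulr0).
case: (eqVneq (j.1.2 : nat) 0%N) => [->|_] /=; last by rewrite !(mul0r, mulr0).
by rewrite /mulc !expr0 !mul1r.
Qed.

Lemma tau_conv (E F : lmodType K) (op : E -> F -> A) (f : A -> A -> E)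
    (g : A -> A -> F) x y :
  tau (conv op f g x y) = conv (fun a b => tau (op a b) : K^o) f g x y.
Proof.
have tauD (V : finType) (c : V -> K) (z : V -> A) :
    tau (\sum_s c s *: z s) = \sum_s c s * tau (z s).
  by rewrite tauE Defs.coef_sum; apply: eq_bigr => s _; rewrite Defs.coefZ tauE.
rewrite tauE Defs.coef_sum; apply: eq_bigr => p _; rewrite -tauE.
exact: tauD.
Qed.

(* The middle factor of [alpha * m_A * alpha^-1] survives [tau] only on
   grouplikes, where it contributes the indicator of [g * h = 1]. *)
Lemma form_ffun_tau_twisted f :
  form_ffun (fun x y => tau (twisted_mul f x y)) =
  cv dcoef2 [ffun u => form_ffun f u * (u.1.2 * u.2.2 == 1)%g%:R]
    (form_ffun (conv_inv f)).
Proof.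
pose scal (a : K^o) (z : A) : A := (a : K) *: z.
have inner : form_ffun (fun x y => tau (conv scal f (fun x y => x * y) x y)) =
    [ffun u => form_ffun f u * (u.1.2 * u.2.2 == 1)%g%:R].
  transitivity (form_ffun (conv (fun a z => tau (scal a z) : K^o) f (fun x y => x * y))).
    by apply/ffunP => u; rewrite !ffunE tau_conv.
  rewrite form_ffun_conv; apply/ffunP => u; rewrite !ffunE.
  have /ffunP/(_ u) := cvf1 dcoef2_counitr (form_ffun f).
  rewrite [form_ffun f u]ffunE => <-; rewrite ffunE mulr_suml; apply: eq_bigr => v _.
  rewrite mulr_suml; apply: eq_bigr => w _.
  rewrite /scal tauE Defs.coefZ -tauE tau_mul_bas -(eps2_bE w) [form_ffun f v]ffunE.
  case: (eqVneq (dcoef2 u v w) 0) => [->|/dcoef2_neq0]; first by rewrite !mul0r.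
  by move=> [_ _ _ [-> ->]]; rewrite !mulrA.
rewrite -inner; apply/ffunP => u.
transitivity (form_ffun (conv (fun z (a : K^o) => tau (scal a z) : K^o)
    (conv scal f (fun x y => x * y)) (conv_inv f)) u).
  by rewrite !ffunE tau_conv.
rewrite form_ffun_conv !ffunE; apply: eq_bigr => v _; apply: eq_bigr => w _.
by rewrite !ffunE /scal tauE Defs.coefZ -tauE [_ * tau _]mulrC.
Qed.

(** The bounds are the largest total degrees of two basis monomials, whose exponents are at most
    [r1 D - 1] and [r2 D - 1]. *)
Hypothesis Q_gdeg : forall m n, (m <= 2 * r1 D - 2)%N -> (n <= 2 * r2 D - 2)%N ->
  Q m n -> gdeg D m n <> 1%g.

(** The group parts of the left factors multiply to [gdeg] of the total degree of [w]. Hence the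
    indicator is [1] in degree zero and [0] on [Q], and it reduces the inverse of [f] to the
    counit. *)
Lemma tau_twisted_bas f i j : unip (form_ffun f) -> i.2 = 1%g -> j.2 = 1%g ->
  tau (twisted_mul f (bas i) (bas j)) = f (bas i) (bas j).
Proof.
move=> uf i1 j1; have uh := unipotent_conv_inv uf.
have /ffunP/(_ (i, j)) := form_ffun_tau_twisted f; rewrite ffunE /= => ->.
(* Writing [f] as its convolution with the counit allows a comparison term by term. *)
have := cvf1 dcoef2_counitr (form_ffun f); move=> /ffunP/(_ (i, j)).
rewrite [in RHS]ffunE /= => <-; rewrite !ffunE.
apply: eq_bigr => v _; apply: eq_bigr => w _; rewrite ffunE.
case: (eqVneq (dcoef2 (i, j) v w) 0) => [->|/dcoef2_neq0]; first by rewrite !mul0r.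
rewrite /= i1 j1 !mulg1 => -[[e1 e2 e3 e4] -> -> _]; rewrite -(gdegD D abG).
congr (_ * _); rewrite -mulrA; congr (_ * _).
case: (eqVneq (form_ffun (conv_inv f) w) (eps2_b w)) => [->|/uh Qw].
  case: (eqVneq (eps2_b w) 0) => [->|/eps2_b_neq0[_ [-> -> -> ->]]].
    by rewrite mulr0.
  by rewrite /gdeg !expg0 mulg1 eqxx mul1r.
have -> : eps2_b w = 0.
  apply: contraTeq (Q_pos Qw) => /eps2_b_neq0[_ [-> -> -> ->]] //.
case: eqP => [E|_]; last by rewrite mul0r.
have bnd (r : nat) (x y : 'I_r) : (x + y <= 2 * r - 2)%N.
  by have := ltn_ord x; have := ltn_ord y; lia.
by case: (Q_gdeg (bnd _ _ _) (bnd _ _ _) Qw E).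
Qed.

Lemma tau_twisted f : bilinear_map f -> unip (form_ffun f) ->
  forall x y, in_R x -> in_R y -> tau (twisted_mul f x y) = f x y.
Proof.
move=> bf uf x y.
have inR z : in_R z -> exists c : 'I_(r1 D) * 'I_(r2 D) -> K,
    z = \sum_n c n *: bas (n, 1%g).
  move=> [c ->]; exists (fun n => c n.1 n.2); rewrite sum_prod.
  apply: eq_bigr => n1 _; apply: eq_bigr => n2 _.
  by rewrite /bas mon_genE grp1 mulr1.
move=> /inR[c ->] /inR[c' ->].
have bt : bilinear_map (fun x y => tau (twisted_mul f x y) : K^o).
  have [tl tr] := conv_bilinear (fun (z : A) (a : K^o) => (a : K) *: z)
    (conv (fun (a : K^o) (z : A) => (a : K) *: z) f (fun x y => x * y)) (conv_inv f).
  by split=> *; rewrite /twisted_mul ?tl ?tr tau_linear.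
rewrite (bilinear_sum _ _ _ _ bt) bilinear_sum //.
by apply: eq_bigr => n _; apply: eq_bigr => m _; rewrite tau_twisted_bas.
Qed.

End Forms.

(** * The degrees occurring in alpha *)

Section AlphaDegree.
Variables (K : fieldType) (G : finGroupType) (D : quantum_plane K G).
Variables (a1 a2 a : K).
Hypothesis abG : abelian [set: G].
Hypothesis lift : lifting_scalars D a1 a2 a.

(* The nonzero total degrees on which [alpha] or its convolution inverse may
   differ from [eps (x) eps]. *)
Definition alpha_degree (m n : nat) := (0 < m + n)%N /\
  exists k s t, [/\ m = (k + s * r1 D)%N, n = (k + t * r2 D)%N,
    (k != 0)%N -> a != 0, (s != 0)%N -> a1 != 0 & (t != 0)%N -> a2 != 0].

Lemma alpha_degreeD m n m' n' :
  alpha_degree m n -> alpha_degree m' n' -> alpha_degree (m + m') (n + n').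
Proof.
move=> [mn [k [s [t [em en ka sa ta]]]]] [_ [k' [s' [t' [em' en' ka' sa' ta']]]]].
split; first by rewrite addnACA addn_gt0 mn.
exists (k + k')%N, (s + s')%N, (t + t')%N; split;
  rewrite ?em ?en ?em' ?en' ?mulnDl 1?addnACA //.
- by rewrite addn_eq0 negb_and => /orP[/ka|/ka'].
- by rewrite addn_eq0 negb_and => /orP[/sa|/sa'].
- by rewrite addn_eq0 negb_and => /orP[/ta|/ta'].
Qed.

Local Notation unip := (unipotent (eps2_b D) (tdeg_in alpha_degree)).

(** The three factors contribute the degrees [(k, k)], [(r_1, 0)] and [(0, r_2)], and convolution
    only adds degrees. *)
Lemma unipotent_alpha : unip (form_ffun (alpha D a1 a2 a)).
Proof.
apply: (unipotent_fconv alpha_degreeD);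
    [apply: (unipotent_fconv alpha_degreeD)|]; apply: unipotent_Hext => n1 n2 m1 m2.
- case: ifP => [/and4P[/eqP-> n2r /eqP-> /eqP->]|_]; last by rewrite eqxx.
  (* At [m = 0] the listed value of [gamma_a] is [1], the value of the counit. *)
  case: n2 n2r => [|n] nr; first by rewrite qfact0 mul1r expr0 /eps_val /= eqxx.
  rewrite [eps_val _ _ _ _ _](_ : _ = 0) // => nz; split; first by lia.
  exists n.+1, 0%N, 0%N; split; rewrite ?mul0n ?addn0 //.
  by move=> _; apply: contraNneq nz => ->; rewrite expr0n mulr0.
- case: ifP => [/and4P[n1r /eqP-> /eqP-> /eqP->]|_]; last by rewrite eqxx.
  rewrite [eps_val _ _ _ _ _](_ : _ = 0); last by case: n1 n1r.
  by move=> nz; split; first lia; exists 0%N, 1%N, 0%N; split=> //; lia.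
case: ifP => [/and4P[/eqP-> n2r /eqP-> /eqP->]|_]; last by rewrite eqxx.
rewrite [eps_val _ _ _ _ _](_ : _ = 0); last by case: n2 n2r.
by move=> nz; split; first lia; exists 0%N, 0%N, 1%N; split=> //; lia.
Qed.

Lemma gdeg_diag k : gdeg D k k = ((g1 D * g2 D) ^+ k)%g.
Proof. by rewrite /gdeg expgMn //; apply: mulgC_ab. Qed.

Lemma chi1X g n : chi1 D (g ^+ n)%g = chi1 D g ^+ n.
Proof. by elim: n => [|n IHn]; rewrite ?chi1_1 // expgS exprS chi1M IHn. Qed.

(* As [chi1 chi2 = eps], also [chi1 (g2) = q], so [chi1] detects degrees mod [r]. *)
Lemma chi1_gdeg m n : a != 0 -> chi1 D (gdeg D m n) = chi1 D (g1 D) ^+ (m + n).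
Proof.
have [_ _ H] := lift; move=> /H[_ chi12V].
have -> : chi1 D (g1 D) = chi1 D (g2 D).
  by apply: (mulIf (chi2_neq0 D (g1 D))); rewrite chi12V chi12.
rewrite /gdeg chi1M !chi1X exprD; congr (_ ^+ _ * _).
by apply: (mulIf (chi2_neq0 D (g1 D))); rewrite chi12V chi12.
Qed.

End AlphaDegree.

(** * Nontriviality of the grouplikes in the four cases *)

Unset Implicit Arguments.

Theorem theorem4p4 (K : fieldType) (charK : [pchar K] =i pred0)
    (G : finGroupType) (abG : abelian [set: G]) (D : quantum_plane K G)
    (a1 a2 a : K) (lift : lifting_scalars D a1 a2 a)
    (cond :
      (* (i) *)
      (a = 0 /\ (a1 = 0 \/ a2 = 0)) \/
      (* (ii) *)
      (a = 0 /\ (g1 D ^+ r1 D * g2 D ^+ r2 D)%g <> 1%g) \/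
      (* (iii) *)
      (exists r : nat, [/\ r = r1 D, r = r2 D, a <> 0, odd r \/ r = 2%N
         & ((g1 D * g2 D) ^+ r)%g <> 1%g]) \/
      (* (iv) *)
      (exists r r' : nat,
        [/\ r = r1 D /\ r = r2 D, a <> 0, r = (2 * r')%N /\ (2 < r)%N,
            forall t : nat, (1 <= t <= 3)%N ->
              ((g1 D * g2 D) ^+ (t * r'))%g <> 1%g
          & ((g1 D * g2 D) ^+ r' * g2 D ^+ r)%g <> 1%g /\
            (g1 D ^+ r * (g1 D * g2 D) ^+ r')%g <> 1%g])) :
  forall x y : biproduct D, in_R x -> in_R y ->
    total_integral (eps_cocycle (alpha D a1 a2 a) x y) = alpha D a1 a2 a x y.
Proof.
apply: (tau_twisted abG (@alpha_degreeD K G D a1 a2 a));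
  [by move=> m n [] | | exact: conv_bilinear | exact: unipotent_alpha].
move=> m n mr nr [mn [k [s [t [em en ka sa ta]]]]]; have [l1 l2 l] := lift.
have r1g := r1_ge2 D; have r2g := r2_ge2 D.
(* Two copies of [r1 D] already exceed the bound [2 * r1 D - 2]. *)
have s1 : (s <= 1)%N.
  by rewrite leqNgt; apply/negP => s2; have := leq_mul s2 (leqnn (r1 D)); lia.
have t1 : (t <= 1)%N.
  by rewrite leqNgt; apply/negP => t2; have := leq_mul t2 (leqnn (r2 D)); lia.
have [k0|k_gt0] := posnP k.
  (* In case (i) one of [a1], [a2] vanishes; (ii) is the claim itself; in (iii) and (iv) the element
     is [(g_1 g_2)^r], with [t = 2] in (iv). *)
  have a1a2 : s = 1%N -> t = 1%N -> (g1 D ^+ r1 D * g2 D ^+ r2 D)%g <> 1%g.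
    move=> es et; case: cond => [[_]|[[]//|[[r]|[r [r']]]]].
    - by case=> E; [move: sa; rewrite es|move: ta; rewrite et]; rewrite E eqxx => /(_ isT).
    - by move=> [<- <- _ _]; rewrite -(gdeg_diag D abG).
    move=> [[<- <-] _ [-> _] H _]; have := H 2%N isT.
    by rewrite -(gdeg_diag D abG).
  case: s s1 em sa a1a2 => [|[|//]] _ em sa; case: t t1 en ta => [|[|//]] _ en ta a1a2.
  - by lia.
  - have [g2r _] := l2 (ta isT).
    by rewrite em en k0 /gdeg expg0 mul1g add0n mul1n; apply/eqP.
  - have [g1r _] := l1 (sa isT).
    by rewrite em en k0 /gdeg expg0 mulg1 add0n mul1n; apply/eqP.
  by rewrite em en k0 !add0n !mul1n; apply: a1a2.
have a0 : a != 0 by apply: ka; lia.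
have rr := lifting_r1_r2 lift a0.
(* Applying [chi1] gives that [r] divides [m + n], hence [2 k = c r]; the bound [k <= 2 r - 2]
   leaves [c] in [{1, 2, 3}]. *)
move=> E; have /eqP := chi1_gdeg lift m n a0; rewrite E chi1_1 eq_sym.
rewrite -(prim_order_dvd (chi1_prim D)).
have -> : (m + n = (s + t) * r1 D + 2 * k)%N by rewrite em en -rr; lia.
rewrite dvdn_addr; last exact: dvdn_mull.
move=> /dvdnP[c ec].
have c3 : (c <= 3)%N.
  by rewrite leqNgt; apply/negP => c4; have := leq_mul c4 (leqnn (r1 D)); lia.
have c1 : (0 < c)%N by case: c ec {c3} => //; lia.
(* From [k = r - 1] on, there is no room for a further [r] in either coordinate. *)
have st : (r1 D <= k.+1)%N -> s = 0%N /\ t = 0%N.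
  move=> k_ge; case: s s1 em {sa} => [|[|//]] _ em;
    by case: t t1 en {ta} => [|[|//]] _ en; lia.
move: E; rewrite em en (gdegD D abG) (gdeg_diag D abG) -rr.
case: cond => [[/eqP]|[[/eqP]|[[r [er _ _ odd_r gr]]|[r [r' [[er _] _ [r2r' r3] gt [g1' g2']]]]]]].
- by rewrite (negPf a0).
- by rewrite (negPf a0).
(* For odd [r] the factor [c] is even, so [c = 2] and [k = r]; for [r = 2] the bound gives [k = 1]
   or [k = 2]. The value [k = 1] is excluded by the lifting condition on [a]. *)
- subst r; have [ck st0] : (k = r1 D \/ k = 1%N /\ r1 D = 2%N) /\ (r1 D <= k.+1)%N.
    case: odd_r => [odd_r|er]; last by lia.
    have : ~~ odd (c * r1 D) by rewrite -ec oddM.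
    rewrite oddM odd_r andbT; case: c c1 c3 ec => [|[|[|[]]]] //; lia.
  have [-> ->] := st st0; rewrite !mul0n /gdeg !expg0 !mulg1.
  case: ck => [->//|[-> _]]; rewrite expg1.
  by have [/eqP] := l a0.
subst r; have kc : k = (c * r')%N.
  by apply/eqP; rewrite -(eqn_pmul2l (isT : 0 < 2)%N) ec r2r' mulnCA.
(* For [c = 1] the four choices of [(s, t)] match the hypotheses with [t = 1], the two mixed ones,
   and [t = 3], since [r' + r = 3 r']. For larger [c], [k >= r] forces [s = t = 0]. *)
have [c_eq1|c_ge2] : c = 1%N \/ (2 <= c)%N by lia.
  rewrite kc c_eq1 mul1n.
  case: s s1 {em sa st} => [|[|//]] _; case: t t1 {en ta} => [|[|//]] _;
    rewrite ?mul0n ?mul1n /gdeg ?expg0 ?mulg1 ?mul1g => //.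
  - by move: (gt 1%N isT); rewrite mul1n.
  - by rewrite (mulgC_ab abG).
  move: (gt 3%N isT); rewrite mulSn expgD -[(2 * r')%N]r2r'.
  rewrite -[((_ * _) ^+ r1 D)%g](gdeg_diag D abG).
  by [].
have [|-> ->] := st _; first by have := leq_mul c_ge2 (leqnn r'); lia.
rewrite !mul0n /gdeg !expg0 !mulg1 kc; apply: gt; lia.
Qed.
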